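(* Let $0<a<1$ and $b>0$. Fix $T>0$ and $H\in(1/2,1)$, and let $\vartheta$ be either oscillatory fractional Brownian motion or oscillatory sub-fractional Brownian motion with parameter $H$ (with continuous paths). Let $h$ be as in the definition of these processes. (a) For $\varepsilon>0$ let $$V_\varepsilon(\vartheta)=\varepsilon^{-2H}\int_0^T(\vartheta_{t+\varepsilon}-\vartheta_t)^2\,dt.$$ Then $$\lim_{\varepsilon\to0}\frac1{h_\varepsilon}V_\varepsilon(\vartheta)=T\quad\text{in }L^2.$$ Moreover, if $(\varepsilon_n)_{n=1,2,\dots}$ is a sequence of positive numbers such that $$\sum_{n=1}^\infty\varepsilon_n^\delta<\infty\quad\text{for some }0<\delta<(4-4H)\wedge1,$$ then $\frac1{h_{\varepsilon_n}}V_{\varepsilon_n}(\vartheta)\to T$ almost surely as $n\to\infty$. (b) The same assertions ($L^2$ convergence as $\varepsilon\to0$, and almost sure convergence along every such sequence $(\varepsilon_n)$) hold with $V_\varepsilon(\vartheta)$ replaced by $$U_\varepsilon(\vartheta)=\varepsilon^{1-2H}\sum_{k=1}^{\lfloor T/\varepsilon\rfloor}(\vartheta_{k\varepsilon}-\vartheta_{(k-1)\varepsilon})^2.$$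
   Context: Fix constants $0<a<1$ and $b>0$. For $H\in(1/2,1)$ let $$h_t=\sum_{j\in\mathbb Z}(ba^jt)^{-2H}(e^{-ba^jt}-1+ba^jt),\ t>0,\qquad h_0=0;$$ $h$ is bounded above and bounded away from $0$ on $(0,\infty)$ and $h_{at}=h_t$. - Oscillatory fractional Brownian motion with parameter $H$: centered Gaussian process $\xi^H$ with $E\xi^H_s\xi^H_t=\frac12\left(s^{2H}h_s+t^{2H}h_t-|s-t|^{2H}h_{|s-t|}\right)$, $s,t\ge0$. - Oscillatory sub-fractional Brownian motion with parameter $H$: centered Gaussian process $\zeta^H$ with $E\zeta^H_s\zeta^H_t=s^{2H}h_s+t^{2H}h_t-\frac12\left[(s+t)^{2H}h_{s+t}+|s-t|^{2H}h_{|s-t|}\right]$, $s,t\ge0$. Both have continuous versions, which are used here. $\lfloor\cdot\rfloor$ denotes the integer part. *)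

(* Defs.v *)
From HB Require Import structures.
From mathcomp Require Import all_boot all_order all_algebra.
From mathcomp Require Import all_classical all_reals all_analysis.

Set Implicit Arguments.
Unset Strict Implicit.
Unset Printing Implicit Defensive.

Import Order.TTheory GRing.Theory Num.Theory.
Import numFieldNormedType.Exports.

Local Open Scope classical_set_scope.
Local Open Scope ring_scope.

(* The summands are nonnegative, so the sum over all of Z is an [esum]; it is
   finite when 0 < a < 1, 0 < b and 1/2 < H < 1, so [fine] loses nothing. *)
Definition osc_h (R : realType) (a b H t : R) : R :=
  if t == 0 then 0
  else fine (\esum_(j in [set: int])
    (((b * a ^ j * t) `^ (- (2 * H)) *
      (expR (- (b * a ^ j * t)) - 1 + b * a ^ j * t))%:E)).

Definition osc_fbm_cov (R : realType) (a b H s t : R) : R :=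
  2^-1 * (s `^ (2 * H) * osc_h a b H s + t `^ (2 * H) * osc_h a b H t
          - `|s - t| `^ (2 * H) * osc_h a b H `|s - t|).

Definition osc_subfbm_cov (R : realType) (a b H s t : R) : R :=
  s `^ (2 * H) * osc_h a b H s + t `^ (2 * H) * osc_h a b H t
  - 2^-1 * ((s + t) `^ (2 * H) * osc_h a b H (s + t)
            + `|s - t| `^ (2 * H) * osc_h a b H `|s - t|).

(* Degenerate (constant) Gaussian variables are included: [normal_prob m 0] is
   not the Dirac mass at m, whence the case distinction on the standard
   deviation. *)
Definition gaussian_rv (d : measure_display) (Omega : measurableType d)
    (R : realType) (P : probability Omega R) (Y : Omega -> R) : Prop :=
  measurable_fun [set: Omega] Y /\
  exists m sigma : R, 0 <= sigma /\
    forall A : set R, measurable A ->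
      P (Y @^-1` A) =
        if sigma == 0 then (\d_m A : \bar R) else normal_prob m sigma A.

(* A process indexed by [0, +oo[ is a function on R of which only the values
   at nonnegative times matter. *)
Definition gaussian_process (d : measure_display) (Omega : measurableType d)
    (R : realType) (P : probability Omega R) (X : R -> Omega -> R) : Prop :=
  forall (n : nat) (t c : 'I_n -> R), (forall i, 0 <= t i) ->
    gaussian_rv P (fun w => \sum_(i < n) c i * X (t i) w).

Definition centered_gaussian_process (d : measure_display)
    (Omega : measurableType d) (R : realType) (P : probability Omega R)
    (X : R -> Omega -> R) (K : R -> R -> R) : Prop :=
  [/\ gaussian_process P X,
      forall t : R, 0 <= t -> 'E_P[X t]%E = 0%E &
      forall s t : R, 0 <= s -> 0 <= t ->
        'E_P[(X s \* X t)%R]%E = (K s t)%:E].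

Definition osc_fbm (d : measure_display) (Omega : measurableType d)
    (R : realType) (P : probability Omega R) (a b H : R)
    (X : R -> Omega -> R) : Prop :=
  centered_gaussian_process P X (osc_fbm_cov a b H).

Definition osc_subfbm (d : measure_display) (Omega : measurableType d)
    (R : realType) (P : probability Omega R) (a b H : R)
    (X : R -> Omega -> R) : Prop :=
  centered_gaussian_process P X (osc_subfbm_cov a b H).

Definition continuous_paths (Omega : Type) (R : realType)
    (X : R -> Omega -> R) : Prop :=
  forall w, {within `[0, +oo[, continuous (fun t : R => X t w)}.

Definition V_var (R : realType) (Omega : Type) (H T : R) (X : R -> Omega -> R)
    (eps : R) (w : Omega) : R :=
  eps `^ (- (2 * H)) *
  \int[lebesgue_measure]_(t in `[0, T]) (X (t + eps) w - X t w) ^+ 2.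

Definition U_var (R : realType) (Omega : Type) (H T : R) (X : R -> Omega -> R)
    (eps : R) (w : Omega) : R :=
  eps `^ (1 - 2 * H) *
  \sum_(1 <= k < (Num.truncn (T / eps)).+1)
    (X (k%:R * eps) w - X (k.-1%:R * eps) w) ^+ 2.

Definition cvg_L2 (d : measure_display) (Omega : measurableType d)
    (R : realType) (P : probability Omega R) (I : Type) (F : set_system I)
    (Y : I -> Omega -> R) (Z : Omega -> R) : Prop :=
  [/\ \forall i \near F, Y i \in Lfun P 2%:E,
      Z \in Lfun P 2%:E &
      'N[P]_2%:E[EFin \o (Y i \- Z)%R]%E @[i --> F] --> 0%E].

Definition cvg_as (d : measure_display) (Omega : measurableType d)
    (R : realType) (P : probability Omega R)
    (Y : nat -> Omega -> R) (Z : Omega -> R) : Prop :=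
  {ae P, forall w, Y n w @[n --> \oo] --> Z w}.

(* Main.v *)
Require Import Defs.
From HB Require Import structures.
From mathcomp Require Import all_boot all_order all_algebra.
From mathcomp Require Import all_classical all_reals all_analysis.
From mathcomp Require Import measurable_realfun zify ring lra.

(* Let [f t = t^(2H) h_t]. It is a positive combination of the functions
   [x |-> e^(-l x) - 1 + l x], so it is nondecreasing, its second differences are
   nonnegative and of order [(e / u)^2 f u], and [f (a t) = a^(2H) f t] gives
   [f u <= C (u / e)^(2H) f e] for [e <= u]. Hence the increments
   [X (t + e) - X t] have variance [f e (1 + O((e / t)^(2 - 2H)))] and correlations
   [O((e / |t - s|)^(2 - 2H))]. By Isserlis' formula a normalized sum
   [eta * sum_i (X (i eta + e) - X (i eta))^2 / f e] over a mesh of [0, T] is at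
   squared L2 distance [O(eta + e^delta)] from [T], for every
   [delta < min (4 - 4H, 1)]. Taking [eta = e] gives the statement for [U]; for [V]
   one lets [eta] tend to [0] and applies Fatou's lemma to the Riemann sums, so that
   no Fubini argument is needed. Almost sure convergence follows since the squared
   distances are summable along the sequence. *)

Set Implicit Arguments.
Unset Strict Implicit.
Unset Printing Implicit Defensive.

Import Order.TTheory GRing.Theory Num.Theory.
Import numFieldNormedType.Exports.

Local Open Scope classical_set_scope.
Local Open Scope ring_scope.

(** Since [h] is invariant under [t -> a t], it has no limit at 0 unless it is constant, so no
    limiting variance can be used: everything is normalized by [f e] at the same [e], and the
    estimates must be uniform in [e > 0]. This works because second differences of [f] are compared
    with [f] itself through the scale-free ratio [e / u]. Squared correlations are of order
    [(e / |t - s|)^(4 - 4H)], which need not be integrable near the diagonal. Weakening the exponent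
    to some [delta < 1] keeps the sum over lags bounded independently of the mesh; this is the
    origin of [min (4 - 4H, 1)]. The increments of the sub-fractional process are not stationary.
    Their variance differs from [f e] by half a second difference, which decays away from time 0.
    Hence the sums are centred at [eta * N] instead of their mean, and the squared relative biases
    obey the same bound as the squared correlations. Gaussianity is given through laws, so second
    and fourth moments must first be computed from the normal density, and the location parameter of
    the law must be identified with the mean. *)

(** * Central moments of the normal density *)

Section normal_moments.
Context {R : realType}.
Notation mu := (@lebesgue_measure R).

(** Squaring [expR (y / 2) >= 1 + y / 2] gives [expR y >= y ^+ 2 / 4]. *)
Lemma sqr_expRN_le4 (y : R) : 0 <= y -> y ^+ 2 * expR (- y) <= 4.
Proof.
move=> y0; rewrite expRN ler_pdivrMr ?expR_gt0//.
have -> : expR y = expR (y / 2) ^+ 2 by rewrite -expRM_natl; congr expR; field.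
have := expR_ge1Dx (y / 2) => h.
nra.
Qed.

Lemma cvg_integral_symmetric_itv (g : R -> R) (m : R) :
  mu.-integrable [set: R] (EFin \o g) ->
  (\int[mu]_(x in `[(m - n%:R)%R, (m + n%:R)%R]) (g x)%:E)%E @[n --> \oo] -->
  (\int[mu]_x (g x)%:E)%E.
Proof.
move=> ig; have mg := measurable_int _ ig.
pose A n : set R := `[m - n%:R, m + n%:R]%classic.
under eq_fun do rewrite integral_mkcond.
pose h n : R -> \bar R := (EFin \o g) \_ (A n).
have mh n : measurable_fun [set: R] (h n).
  apply/(measurable_restrictT _ _).1; first exact: measurable_itv.
  exact: measurable_funTS.
have hae : {ae mu, forall x, [set: R] x ->
    h n x @[n --> \oo] --> (EFin \o g) x}.
  apply/aeW => x _; apply: cvg_near_cst; near=> n.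
  rewrite /h patchE mem_set// /A /= in_itv/=.
  have : `|x - m| <= n%:R by near: n; apply: nbhs_infty_ger.
  by rewrite ler_norml => /andP[h1 h2]; apply/andP; split; lra.
have hdom : {ae mu, forall x n, [set: R] x ->
    (`|h n x| <= `|(g x)%:E|)%E}.
  apply/aeW => x n _; rewrite /h patchE; case: ifP => _ //.
  by rewrite [X in (`|X| <= _)%E](_ : _ = 0%E)// abse0 abse_ge0.
by have [] := @dominated_convergence _ _ _ mu _ measurableT
  _ _ _ mh mg hae (integrable_abse ig) hdom.
Unshelve. all: by end_near. Qed.

(** This plays the role of integration by parts: the fundamental theorem of calculus on
    [[m - n, m + n]], then [n] to infinity. Each moment identity below comes from a suitable [G]. *)
Lemma integral_derive_eq0 (G g : R -> R) (m : R) :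
  (forall x : R, is_derive x (1 : R) G (g x)) -> continuous g ->
  mu.-integrable [set: R] (EFin \o g) ->
  G (m + n%:R) @[n --> \oo] --> (0 : R) ->
  G (m - n%:R) @[n --> \oo] --> (0 : R) ->
  (\int[mu]_x (g x)%:E = 0)%E.
Proof.
move=> dG cg ig Gp Gm.
have cG : continuous G.
  move=> x; apply/differentiable_continuous/derivable1_diffP.
  by have [] := dG x.
have h := cvg_integral_symmetric_itv m ig.
apply: cvg_unique h _ => //.
have k : (G (m + n%:R) - G (m - n%:R))%:E @[n --> \oo] --> (0 : R)%:E.
  apply: cvg_EFin; first by near=> n.
  by rewrite -[X in _ --> X]subr0; apply: cvgB.
apply: cvg_trans k; apply: near_eq_cvg; near=> n.
have n0 : (0 : R) < n%:R by rewrite ltr0n; near: n; exists 1%N.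
rewrite (@continuous_FTC2 _ g G) ?EFinB//.
- lra.
- exact: continuous_subspaceT.
- split.
  + by move=> x _; have [] := dG x.
  + exact/cvg_at_right_filter/cG.
  + exact/cvg_at_left_filter/cG.
- by move=> x _; rewrite derive1E; apply: (@derive_val _ _ _ _ _ _ _ (dG x)).
Unshelve. all: by end_near. Qed.

Section density.
Context (m s : R) (s0 : s != 0).
Local Notation p := (normal_pdf m s).

Let s2_gt0 : 0 < s ^+ 2.
Proof. by rewrite exprn_even_gt0. Qed.

Lemma is_derive_normal_pdf (x : R) :
  is_derive x (1 : R) p (- ((x - m) / s ^+ 2) * p x).
Proof.
rewrite normal_pdfE//.
rewrite /normal_fun.
apply: is_derive_eq.
rewrite /GRing.scale /=; field.
exact: s0.
Qed.

(* Since [y^2 e^{-y} <= 4], a polynomial factor only costs half of the Gaussian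
   exponent, and what is left is again a normal density. *)
Lemma normal_pdf_moment_le (k : nat) (x : R) : (k <= 4)%N ->
  `|x - m| ^+ k * p x <= (1 + 64 * s ^+ 4) * normal_peak s / normal_peak (2 * s)
    * normal_pdf m (2 * s) x.
Proof.
move=> k4.
have s20 : 2 * s != 0 by rewrite mulf_neq0.
rewrite !normal_pdfE// /normal_fun mulrA.
set q := (x - m) ^+ 2.
have q0 : 0 <= q by exact: sqr_ge0.
(* Three quarters of the exponent absorb the polynomial; the remaining quarter is the exponent of a
   normal density of standard deviation [2 * s]. *)
have -> : - q / (s ^+ 2 *+ 2) = - (3 * q / (8 * s ^+ 2)) + - (q / (8 * s ^+ 2)).
  by field.
have -> : - q / ((2 * s) ^+ 2 *+ 2) = - (q / (8 * s ^+ 2)) by field.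
rewrite expRD; set y := 3 * q / (8 * s ^+ 2).
have y0 : 0 <= y by rewrite /y; apply: divr_ge0; apply: mulr_ge0 => //; exact: ltW.
have hq : q = 8 / 3 * s ^+ 2 * y by rewrite /y; field.
have hk : `|x - m| ^+ k <= 1 + q ^+ 2.
  have -> : q ^+ 2 = `|x - m| ^+ 4 by rewrite /q -normrX ger0_norm ?exprn_even_ge0// -exprM.
  have [h|/ltW h] := leP `|x - m| 1.
    by rewrite (le_trans (exprn_ile1 _ _ _))// lerDl exprn_ge0.
  by rewrite (le_trans (ler_weXn2l h k4))// lerDr.
have he : `|x - m| ^+ k * expR (- y) <= 1 + 64 * s ^+ 4.
  apply: (@le_trans _ _ ((1 + q ^+ 2) * expR (- y))).
    by rewrite ler_wpM2r ?expR_ge0.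
  rewrite mulrDl mul1r lerD//; first by rewrite -expR0 ler_expR oppr_le0.
  have := sqr_expRN_le4 y0.
  have : 0 <= s ^+ 4 by rewrite exprn_even_ge0.
  (* Here [q ^+ 2 * expR (- y)] is [64 / 9 * s ^+ 4] times a quantity at most 4, so the coefficient
     64 is ample. *)
  rewrite hq => h4 h; rewrite [leLHS](_ : _ = 64 / 9 * s ^+ 4 * (y ^+ 2 * expR (- y))); last by field.
  nra.
have ? := normal_peak_gt0 s0; have ? := normal_peak_gt0 s20.
have -> : (1 + 64 * s ^+ 4) * normal_peak s / normal_peak (2 * s) *
  (normal_peak (2 * s) * expR (- (q / (8 * s ^+ 2)))) =
  (1 + 64 * s ^+ 4) * (normal_peak s * expR (- (q / (8 * s ^+ 2)))).
  by field; rewrite gt_eqF.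
rewrite [leLHS](_ : _ = (`|x - m| ^+ k * expR (- y)) *
  (normal_peak s * expR (- (q / (8 * s ^+ 2))))); last by ring.
by rewrite ler_wpM2r// mulr_ge0 ?expR_ge0 ?ltW.
Qed.

Lemma integrable_normal_pdf_moment (k : nat) : (k <= 4)%N ->
  mu.-integrable [set: R] (EFin \o (fun x => (x - m) ^+ k * p x)).
Proof.
move=> k4; have s20 : 2 * s != 0 by rewrite mulf_neq0.
pose C := (1 + 64 * s ^+ 4) * normal_peak s / normal_peak (2 * s).
apply: (@le_integrable _ _ _ mu _ measurableT _
   (fun x => (C%:E * (normal_pdf m (2 * s) x)%:E)%E)).
- apply/measurable_EFinP/measurable_funM; last exact: measurable_normal_pdf.
  by apply: measurable_funX; exact: measurable_funB.
- move=> x _ /=; rewrite lee_fin normrM normrX (ger0_norm (normal_pdf_ge0 _ _ _)).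
  by apply: (le_trans (normal_pdf_moment_le _ k4)); rewrite ler_norm.
- by apply: integrableZl => //; exact: integrable_normal_pdf.
Qed.

(** One power of [|x - m|] is sacrificed: the bound for exponent [k + 1] gives decay like
    [1 / |x - m|], whence [k <= 3]. *)
Lemma cvg_normal_pdf_moment (k : nat) : (k <= 3)%N ->
  ((m + n%:R) - m) ^+ k * p (m + n%:R) @[n --> \oo] --> (0 : R) /\
  ((m - n%:R) - m) ^+ k * p (m - n%:R) @[n --> \oo] --> (0 : R).
Proof.
move=> k3; have s20 : 2 * s != 0 by rewrite mulf_neq0.
pose K := (1 + 64 * s ^+ 4) * normal_peak s / normal_peak (2 * s) *
  normal_peak (2 * s).
have K0 : 0 <= K.
  rewrite !mulr_ge0 ?normal_peak_ge0 ?invr_ge0 ?normal_peak_ge0//.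
  by rewrite addr_ge0// mulr_ge0// exprn_even_ge0.
have bnd x : 1 <= `|x - m| -> `|(x - m) ^+ k * p x| <= K / `|x - m|.
  move=> x1; have x0 : 0 < `|x - m| by exact: lt_le_trans x1.
  rewrite normrM normrX (ger0_norm (normal_pdf_ge0 _ _ _)) ler_pdivlMr//.
  rewrite mulrAC -exprSr.
  apply: le_trans (normal_pdf_moment_le _ _) _ => //.
  rewrite ler_wpM2l ?normal_pdf_ub// !mulr_ge0 ?normal_peak_ge0 ?invr_ge0 ?normal_peak_ge0//.
  by rewrite addr_ge0// mulr_ge0// exprn_even_ge0.
have cv (u : nat -> R) : (forall n, `|u n - m| = n%:R) ->
    (u n - m) ^+ k * p (u n) @[n --> \oo] --> (0 : R).
  move=> hu; apply/cvgr0Pnorm_le => e e0; near=> n.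
  have n1 : (1 : R) <= n%:R by rewrite ler1n; near: n; exists 1%N.
  apply: le_trans (bnd _ _) _; rewrite hu//.
  rewrite ler_pdivrMr ?(lt_le_trans _ n1)// mulrC -ler_pdivrMr//.
  by near: n; apply: nbhs_infty_ger.
split; apply: cv => n.
  by rewrite (_ : m + n%:R - m = n%:R) ?normr_nat//; ring.
by rewrite (_ : m - n%:R - m = - n%:R) ?normrN ?normr_nat//; ring.
Unshelve. all: by end_near. Qed.

Lemma continuous_normal_pdf_moment (k : nat) (c : R) :
  continuous (fun x => c * ((x - m) ^+ k * p x)).
Proof.
move=> x; apply: cvgM; first exact: cvg_cst.
apply: cvgM; last exact: continuous_normal_pdf.
apply: (cvg_comp (fun x => x - m) (fun x => x ^+ k)); last exact: exprn_continuous.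
by apply: cvgB; [exact: cvg_id | exact: cvg_cst].
Qed.

(** An antiderivative is [- s ^+ 2 * p]; the factor [(x - m) ^+ 0] is kept so that the general limit
    lemma applies to it. *)
Lemma integral_normal_pdf_moment1 : (\int[mu]_x ((x - m) * p x)%:E = 0)%E.
Proof.
have [cp cm] := @cvg_normal_pdf_moment 0 isT.
apply: (@integral_derive_eq0 (fun x => - s ^+ 2 * ((x - m) ^+ 0 * p x)) _ m).
- move=> x; under eq_fun do rewrite expr0 mul1r.
  have := is_derive_normal_pdf x => h.
  by apply: is_derive_eq; rewrite /GRing.scale/=; field.
- move=> x; have := @continuous_normal_pdf_moment 1 1 x.
  by under eq_fun do rewrite mul1r expr1.
- have := @integrable_normal_pdf_moment 1 isT.
  by apply: eq_integrable => //= x _; rewrite expr1.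
- by rewrite -[X in _ --> X](mulr0 (- s ^+ 2)); apply: cvgM => //; exact: cvg_cst.
- by rewrite -[X in _ --> X](mulr0 (- s ^+ 2)); apply: cvgM => //; exact: cvg_cst.
Qed.

(** The derivative of [- s ^+ 2 * (x - m) ^+ k.+1 * p] is the difference of the two integrands, and
    it integrates to 0. *)
Lemma integral_normal_pdf_momentSS (k : nat) : (k <= 2)%N ->
  (\int[mu]_x ((x - m) ^+ k.+2 * p x)%:E =
   (k.+1%:R * s ^+ 2)%:E * \int[mu]_x ((x - m) ^+ k * p x)%:E)%E.
Proof.
move=> k2.
have ik := @integrable_normal_pdf_moment k (@leq_trans 2 k 4 k2 isT).
have ikk := @integrable_normal_pdf_moment k.+2 k2.
have [cp cm] := @cvg_normal_pdf_moment k.+1 k2.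
have ikc : mu.-integrable [set: R]
    (EFin \o (fun x => k.+1%:R * s ^+ 2 * ((x - m) ^+ k * p x))).
  exact: eq_integrable (integrableZl measurableT (k.+1%:R * s ^+ 2) ik).
suff : (\int[mu]_x ((x - m) ^+ k.+2 * p x -
    k.+1%:R * s ^+ 2 * ((x - m) ^+ k * p x))%:E = 0)%E.
  rewrite integralB_EFin//.
  under [X in (_ - X)%E]eq_integral do rewrite EFinM.
  rewrite integralZl// => h.
  set c := (X in _ = X).
  have cfin : c \is a fin_num by rewrite fin_numM//; exact: integrable_fin_num ik.
  by rewrite -[LHS](subeK _ cfin) /c h add0e.
apply: (@integral_derive_eq0 (fun x => - s ^+ 2 * ((x - m) ^+ k.+1 * p x)) _ m).
- move=> x.
  have dp := is_derive_normal_pdf x.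
  have dX : is_derive x (1 : R) (fun x => (x - m) ^+ k.+1) (k.+1%:R * (x - m) ^+ k).
    rewrite (_ : (fun x => _) = (fun x : R => x - m) ^+ k.+1); last first.
      by apply/funext => y; rewrite exprfctE.
    have dB : is_derive x (1 : R) (fun x : R => x - m) 1.
      by apply: is_derive_eq; rewrite subr0.
    by apply: is_derive_eq; rewrite /GRing.scale/= mulr1.
  by apply: is_derive_eq; rewrite /GRing.scale/= !exprS; field; exact: s0.
- move=> x; apply: cvgB; last exact: continuous_normal_pdf_moment.
  have := @continuous_normal_pdf_moment k.+2 1 x.
  by under eq_fun do rewrite mul1r.
- exact: eq_integrable (integrableB measurableT ikk ikc).
- by rewrite -[X in _ --> X](mulr0 (- s ^+ 2)); apply: cvgM => //; exact: cvg_cst.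
- by rewrite -[X in _ --> X](mulr0 (- s ^+ 2)); apply: cvgM => //; exact: cvg_cst.
Qed.

Lemma integral_normal_pdf_moment2 :
  (\int[mu]_x ((x - m) ^+ 2 * p x)%:E = (s ^+ 2)%:E)%E.
Proof.
rewrite integral_normal_pdf_momentSS// mul1r.
under eq_integral do rewrite expr0 mul1r.
by rewrite integral_normal_pdf mule1.
Qed.

Lemma integral_normal_pdf_moment4 :
  (\int[mu]_x ((x - m) ^+ 4 * p x)%:E = (3 * s ^+ 4)%:E)%E.
Proof.
rewrite integral_normal_pdf_momentSS// integral_normal_pdf_moment2 -EFinM.
by congr EFin; ring.
Qed.

End density.

End normal_moments.

(** * Moments of a Gaussian random variable from its law *)

Section gaussian_moments.
Context {R : realType}.
Notation mu := (@lebesgue_measure R).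

(** Change of variables holds for the Radon-Nikodym derivative, which equals [normal_pdf] almost
    everywhere because both have the same integral over every measurable set. *)
Lemma ge0_integral_normal_prob (m s : R) (f : R -> \bar R) :
  measurable_fun [set: R] f -> (forall x, 0 <= f x)%E ->
  (\int[normal_prob m s]_x f x = \int[mu]_x (f x * (normal_pdf m s x)%:E))%E.
Proof.
move=> mf f0; have dom := @normal_prob_dominates R m s.
rewrite -(Radon_Nikodym_SigmaFinite.change_of_variables dom)//.
apply: ae_eq_integral => //.
- apply: emeasurable_funM => //; apply: (measurable_int mu).
  exact: Radon_Nikodym_SigmaFinite.f_integrable.
- apply: emeasurable_funM => //; apply/measurable_EFinP.
  exact: measurable_normal_pdf.
- apply: ae_eqe_mul2l => /=; apply: integral_ae_eq => //=.
  + exact: Radon_Nikodym_SigmaFinite.f_integrable.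
  + by apply/measurable_EFinP; exact: measurable_normal_pdf.
  + by move=> E _ mE; rewrite -Radon_Nikodym_SigmaFinite.f_integral.
Qed.

Context d (Omega : measurableType d) (P : probability Omega R).

Lemma integrable_EFin_cst (c : R) : P.-integrable [set: Omega] (EFin \o cst c).
Proof. exact: finite_measure_integrable_cst. Qed.

Lemma integrable_EFinD (f g : Omega -> R) :
  P.-integrable [set: Omega] (EFin \o f) ->
  P.-integrable [set: Omega] (EFin \o g) ->
  P.-integrable [set: Omega] (EFin \o (fun w => f w + g w)).
Proof.
by move=> fi gi; apply: eq_integrable (integrableD measurableT fi gi).
Qed.

Lemma integrable_EFinZ (c : R) (f : Omega -> R) :
  P.-integrable [set: Omega] (EFin \o f) ->
  P.-integrable [set: Omega] (EFin \o (fun w => c * f w)).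
Proof. by move=> fi; apply: eq_integrable (integrableZl measurableT c fi). Qed.

Lemma integrable_EFinB (f g : Omega -> R) :
  P.-integrable [set: Omega] (EFin \o f) ->
  P.-integrable [set: Omega] (EFin \o g) ->
  P.-integrable [set: Omega] (EFin \o (fun w => f w - g w)).
Proof.
by move=> fi gi; apply: eq_integrable (integrableB measurableT fi gi).
Qed.

Lemma Rintegral_prob_cst (c : R) : \int[P]_w c = c.
Proof. by have := expectation_cst P c; rewrite unlock /Rintegral => ->. Qed.

Lemma ge0_integrable_EFin (f : Omega -> R) (c : R) :
  measurable_fun [set: Omega] f -> (forall w, 0 <= f w) ->
  (\int[P]_w (f w)%:E = c%:E)%E -> P.-integrable [set: Omega] (EFin \o f).
Proof.
move=> mf f0 fc; apply/integrableP; split; first exact/measurable_EFinP.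
by under eq_integral do rewrite /= ger0_norm//; rewrite fc ltry.
Qed.

Lemma gaussian_rv_ge0_integral (Y : Omega -> R) : gaussian_rv P Y ->
  exists m s : R, forall f : R -> R,
    measurable_fun [set: R] f -> (forall x, 0 <= f x) ->
    (\int[P]_w (f (Y w))%:E =
      if s == 0%R then (f m)%:E else \int[mu]_x (f x * normal_pdf m s x)%:E)%E.
Proof.
move=> [mY [m [s [_ lawY]]]]; exists m, s => f mf f0.
have mEf : measurable_fun [set: R] (EFin \o f) by exact/measurable_EFinP.
case: ifPn => s0.
  transitivity (\int[pushforward P Y]_x (f x)%:E)%E.
    by rewrite ge0_integral_pushforward// => x _; rewrite lee_fin.
  transitivity (\int[\d_m]_x (f x)%:E)%E; last by rewrite integral_dirac//= diracT mul1e.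
  by apply: eq_measure_integral => A mA _; have := lawY A mA; rewrite s0.
pose Ymix := @isMeasurableFun.Build _ _ Omega (measurableTypeR R) Y mY.
pose Yf : {mfun Omega >-> measurableTypeR R} := HB.pack Y Ymix.
transitivity (\int[pushforward P Yf]_x (f x)%:E)%E.
  by rewrite ge0_integral_pushforward// => x _; rewrite lee_fin.
transitivity (\int[normal_prob m s]_x (f x)%:E)%E.
  apply: eq_measure_integral => A mA _.
  by have := lawY A mA; rewrite (negbTE s0).
by rewrite ge0_integral_normal_prob// => x; rewrite lee_fin.
Qed.

(* The moment of [Y - m + 1] identifies the mean of [Y] with [m] using
   integrals of nonnegative functions only. *)
Lemma gaussian_rv_moments (Y : Omega -> R) : gaussian_rv P Y ->
  exists m s : R, [/\
    (\int[P]_w ((Y w - m) ^+ 2)%:E = (s ^+ 2)%:E)%E,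
    (\int[P]_w ((Y w - m + 1) ^+ 2)%:E = (s ^+ 2 + 1)%:E)%E &
    (\int[P]_w ((Y w - m) ^+ 4)%:E = (3 * s ^+ 4)%:E)%E].
Proof.
move=> /gaussian_rv_ge0_integral[m [s lawY]]; exists m, s.
have mp (c : R) k : measurable_fun [set: R] (fun x => (x - m + c) ^+ k).
  by apply: measurable_funX; apply: measurable_funD => //; exact: measurable_funB.
have mp0 k : measurable_fun [set: R] (fun x => (x - m) ^+ k).
  by apply: measurable_funX; exact: measurable_funB.
rewrite !(lawY (fun x => (x - m) ^+ _)) ?(lawY (fun x => (x - m + 1) ^+ _))//;
  try by move=> x; rewrite exprn_even_ge0.
case: ifPn => [/eqP ->|s0].
  by split; congr EFin; ring.
split; [exact: integral_normal_pdf_moment2 | | exact: integral_normal_pdf_moment4].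
have i0 := @integrable_normal_pdf_moment _ m s s0 0 isT.
have i1 := @integrable_normal_pdf_moment _ m s s0 1 isT.
have i2 := @integrable_normal_pdf_moment _ m s s0 2 isT.
have e0 := @integral_normal_pdf R m s.
have e1 := integral_normal_pdf_moment1 m s0.
have e2 := integral_normal_pdf_moment2 m s0.
transitivity (\int[mu]_x (((x - m) ^+ 2 * normal_pdf m s x)%:E +
    ((2%:E * ((x - m) ^+ 1 * normal_pdf m s x)%:E) +
    ((x - m) ^+ 0 * normal_pdf m s x)%:E)))%E.
  by apply: eq_integral => x _; rewrite -EFinM -!EFinD; congr EFin; ring.
rewrite integralD//; last by apply: integrableD => //; exact: integrableZl.
rewrite integralD//; last exact: integrableZl.
rewrite integralZl// e2.
under [X in (_ + (_ * X + _))%E]eq_integral do rewrite expr1.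
under [X in (_ + (_ + X))%E]eq_integral do rewrite expr0 mul1r.
by rewrite e0 e1 mule0 add0e EFinD.
Qed.

(** The parameter [m] of the law is shown to be 0, after which the central moments are the plain
    ones. *)
Lemma centered_gaussian_rv_moments (Y : Omega -> R) : gaussian_rv P Y ->
  'E_P[Y]%E = 0%E ->
  exists s : R, (\int[P]_w ((Y w) ^+ 2)%:E = (s ^+ 2)%:E)%E /\
    (\int[P]_w ((Y w) ^+ 4)%:E = (3 * s ^+ 4)%:E)%E.
Proof.
move=> gY; rewrite unlock => EY; have [mY _] := gY.
have [m [s [Z2 Z12 Z4]]] := gaussian_rv_moments gY.
have mZ : measurable_fun [set: Omega] (fun w => Y w - m) by exact: measurable_funB.
have iZ2 := ge0_integrable_EFin (measurable_funX 2 mZ) (fun w => sqr_ge0 _) Z2.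
have iZ : P.-integrable [set: Omega] (EFin \o (fun w => Y w - m)).
  have i1 : P.-integrable [set: Omega] (EFin \o (fun w => 1 + (Y w - m) ^+ 2)).
    exact: integrable_EFinD (integrable_EFin_cst 1) iZ2.
  apply: le_integrable i1 => //; first exact/measurable_EFinP.
  move=> w _ /=; rewrite lee_fin (ger0_norm (addr_ge0 _ (sqr_ge0 _)))//.
  rewrite -real_normK ?num_real//; have := normr_ge0 (Y w - m); nra.
(* With [Z = Y - m], expanding [(Z + 1) ^+ 2] and comparing its integral [s ^+ 2 + 1] with that of
   [Z ^+ 2] leaves no room for a mean. *)
have Z0 : \int[P]_w (Y w - m) = 0.
  have : \int[P]_w ((Y w - m) ^+ 2 + (2 * (Y w - m) + 1)) = s ^+ 2 + 1.
    rewrite -[RHS]/(fine (s ^+ 2 + 1)%:E) -Z12; congr fine.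
    by apply: eq_integral => w _; congr EFin; ring.
  have i2Z := integrable_EFinZ 2 iZ; have i1 := integrable_EFin_cst 1.
  have := RintegralD measurableT iZ2 (integrable_EFinD i2Z i1).
  have := RintegralD measurableT i2Z i1.
  have Z2R : \int[P]_w ((Y w - m) ^+ 2) = s ^+ 2 by rewrite /Rintegral Z2.
  rewrite /= RintegralZl//= Rintegral_prob_cst Z2R => -> -> h.
  by apply/eqP; rewrite -(inj_eq (mulfI (_ : 2 != 0))) ?mulr0//; apply/eqP; lra.
have m0 : m = 0.
  have : \int[P]_w (Y w - m + m) = 0.
    by rewrite -[RHS]/(fine 0%E) -EY; congr fine; apply: eq_integral => w _; rewrite subrK.
  have := RintegralD measurableT iZ (integrable_EFin_cst m).
  by rewrite /= Z0 Rintegral_prob_cst add0r => ->.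
exists s; split.
  by rewrite -Z2 m0; under [RHS]eq_integral do rewrite subr0.
by rewrite -Z4 m0; under [RHS]eq_integral do rewrite subr0.
Qed.

End gaussian_moments.

(** * The kernel [e^(-x) - 1 + x] and the variogram *)

Section variogram.
Context {R : realType}.

(** One inequality for all positive factors suffices: applied with [c^-1] it yields the reverse
    one. *)
Lemma esumZl (T : choiceType) (I : set T) (c : R) (g : T -> \bar R) :
  0 < c -> (forall i, 0 <= g i)%E ->
  (\esum_(i in I) (c%:E * g i) = c%:E * \esum_(i in I) g i)%E.
Proof.
have le k (h : T -> \bar R) : 0 < k -> (forall i, 0 <= h i)%E ->
    (\esum_(i in I) (k%:E * h i) <= k%:E * \esum_(i in I) h i)%E.
  move=> k0 h0; apply: ge_ereal_sup => _ /= [A AI <-].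
  rewrite -ge0_mule_fsumr// lee_wpmul2l//; first by rewrite lee_fin ltW.
  by apply: ereal_sup_ubound; exists A.
move=> c0 g0; apply/eqP; rewrite eq_le le//=.
have cg0 i : (0 <= c%:E * g i)%E by rewrite mule_ge0// lee_fin ltW.
have ci0 : 0 < c^-1 by rewrite invr_gt0.
have := le _ _ ci0 cg0.
under eq_esum do rewrite muleA -EFinM mulVf ?gt_eqF// mul1e.
by rewrite lee_pdivlMl.
Qed.

(** The kernel of [h]. It is quadratic near 0 and linear at infinity, which makes the series over
    [j] converge at both ends when [1 < 2 * H < 2]. *)
Definition expR_rem (x : R) := expR (- x) - 1 + x.

Lemma expR_rem_ge0 x : 0 <= expR_rem x.
Proof. by rewrite /expR_rem; have := expR_ge1Dx (- x); lra. Qed.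

Lemma expR_rem_gt0 x : 0 < x -> 0 < expR_rem x.
Proof.
move=> x0; have : - x != 0 by rewrite oppr_eq0 gt_eqF.
by move/expR_gt1Dx; rewrite /expR_rem; lra.
Qed.

Lemma expR_rem_le x : 0 <= x -> expR_rem x <= x.
Proof.
move=> x0; rewrite /expR_rem; suff : expR (- x) <= 1 by lra.
by rewrite -expR0 ler_expR; lra.
Qed.

(** Combine [expR x >= 1 + x] with [(1 - x + x ^+ 2) * (1 + x) = 1 + x ^+ 3 >= 1]. *)
Lemma expR_rem_le_sqr x : 0 <= x -> expR_rem x <= x ^+ 2.
Proof.
move=> x0; rewrite /expR_rem expRN.
have h := expR_ge1Dx x; have e0 := expR_gt0 x.
suff : (expR x)^-1 <= 1 - x + x ^+ 2 by lra.
rewrite -[leLHS]mul1r ler_pdivrMr//.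
apply: (@le_trans _ _ ((1 - x + x ^+ 2) * (1 + x))); last first.
  by rewrite ler_wpM2l//; nra.
have : 0 <= x ^+ 3 by rewrite exprn_ge0.
rewrite (_ : (_ + _) * _ = 1 + x ^+ 3); [lra | ring].
Qed.

Lemma le_expR_rem x y : 0 <= x -> x <= y -> expR_rem x <= expR_rem y.
Proof.
move=> x0 xy; rewrite /expR_rem.
have -> : - y = - x + - (y - x) by ring.
rewrite expRD.
have h := expR_ge1Dx (- (y - x)).
have e1 : expR (- x) <= 1 by rewrite -expR0 ler_expR; lra.
have e0 := expR_gt0 (- x).
have : expR (- x) * (1 - expR (- (y - x))) <= 1 - expR (- (y - x)).
  by rewrite ler_piMl// subr_ge0 -expR0 ler_expR; lra.
by rewrite mulrBr mulr1; lra.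
Qed.

(** Two uses of the duplication formula [dbl], with [1 - expR (- z) >= z * expR (- z)] at
    [z = x / 4]. The factor [expR (- (x / 2))] is the one that bounds second differences from above
    when [2 * y <= x]. *)
Lemma expR_rem_ge x : 0 <= x -> x ^+ 2 * expR (- (x / 2)) / 8 <= expR_rem x.
Proof.
move=> x0.
have dbl (z : R) : expR_rem (2 * z) = (1 - expR (- z)) ^+ 2 + 2 * expR_rem z.
  rewrite /expR_rem (_ : - (2 * z) = - z + - z); last by ring.
  by rewrite expRD; ring.
have low (z : R) : 0 <= z -> z * expR (- z) <= 1 - expR (- z).
  move=> z0; have h := expR_ge1Dx z; have e0 := expR_gt0 z.
  rewrite expRN; suff : (z + 1) / expR z <= 1 by rewrite mulrDl mul1r; lra.
  by rewrite ler_pdivrMr// mul1r; lra.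
have := dbl (x / 2); have := dbl (x / 4).
have -> : 2 * (x / 4) = x / 2 by field.
have -> : 2 * (x / 2) = x by field.
have x40 : 0 <= x / 4 by lra.
have r0 := expR_rem_ge0 (x / 4).
have := low _ x40 => h1 h2 h3.
have : (x / 4 * expR (- (x / 4))) ^+ 2 <= (1 - expR (- (x / 4))) ^+ 2.
  by rewrite ler_sqr// nnegrE ?mulr_ge0 ?expR_ge0// (le_trans _ h1)// mulr_ge0 ?expR_ge0.
have -> : (x / 4 * expR (- (x / 4))) ^+ 2 = x ^+ 2 * expR (- (x / 2)) / 16.
  rewrite exprMn -expRM_natl (_ : 2%:R * - (x / 4) = - (x / 2)); last by field.
  by field.
have := sqr_ge0 (1 - expR (- (x / 2))).
lra.
Qed.

(** The affine part cancels, and the exponential part is a perfect square times an exponential; both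
    the sign and the size of second differences follow. *)
Lemma expR_rem_diff2 (x y : R) :
  expR_rem (x + y) - 2 * expR_rem x + expR_rem (x - y) =
  expR (- x + y) * (1 - expR (- y)) ^+ 2.
Proof.
rewrite /expR_rem (_ : - (x + y) = (- x + y) + (- y + - y)); last by ring.
rewrite (_ : - (x - y) = - x + y); last by ring.
rewrite [expR (- x)](_ : _ = expR (- x + y + - y)); last by congr expR; ring.
by rewrite !expRD; ring.
Qed.

Lemma expR_rem_diff2_ge0 (x y : R) :
  2 * expR_rem x <= expR_rem (x + y) + expR_rem (x - y).
Proof.
have := expR_rem_diff2 x y.
have : 0 <= expR (- x + y) * (1 - expR (- y)) ^+ 2.
  by rewrite mulr_ge0 ?expR_ge0 ?sqr_ge0.
lra.
Qed.

Lemma expR_rem_diff2_le (x y : R) : 0 < x -> 0 <= y -> 2 * y <= x ->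
  expR_rem (x + y) + expR_rem (x - y) <= (2 + 8 * (y / x) ^+ 2) * expR_rem x.
Proof.
move=> x0 y0 yx.
have := expR_rem_diff2 x y; have := expR_rem_ge (ltW x0).
have h : expR (- x + y) * (1 - expR (- y)) ^+ 2 <= y ^+ 2 * expR (- (x / 2)).
  rewrite mulrC ler_pM ?expR_ge0 ?sqr_ge0 ?ler_expR//; last lra.
  have := expR_ge1Dx (- y) => hy.
  rewrite ler_sqr ?nnegrE//; first lra.
  by rewrite subr_ge0 -expR0 ler_expR; lra.
move=> h1 h2.
have : (y / x) ^+ 2 * (x ^+ 2 * expR (- (x / 2)) / 8) <= (y / x) ^+ 2 * expR_rem x.
  by rewrite ler_wpM2l ?sqr_ge0.
have -> : (y / x) ^+ 2 * (x ^+ 2 * expR (- (x / 2)) / 8) = y ^+ 2 * expR (- (x / 2)) / 8.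
  by field; rewrite gt_eqF.
lra.
Qed.

(** * Monotonicity, convexity, scaling and growth of the variogram *)

Section osc.
Context (a b H : R).
Hypotheses (a_gt0 : 0 < a) (a_lt1 : a < 1) (b_gt0 : 0 < b).
Hypotheses (H_gt : 2^-1 < H) (H_lt1 : H < 1).

Definition osc_variogram (t : R) := t `^ (2 * H) * osc_h a b H t.
Local Notation f := osc_variogram.

Let term (t : R) (j : int) : R :=
  (b * a ^ j) `^ (- (2 * H)) * expR_rem (b * a ^ j * t).

Let scale_gt0 j : 0 < b * a ^ j.
Proof. by rewrite mulr_gt0// exprz_gt0. Qed.

Let term_ge0 t j : 0 <= term t j.
Proof. by rewrite mulr_ge0 ?powR_ge0// expR_rem_ge0. Qed.

(** The integers split into the ranges of [Posz] and [Negz], and each half has partial sums at most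
    [C / (1 - q)]. *)
Lemma esum_int_geometric_lty (g : int -> R) (q C : R) : (forall j, 0 <= g j) ->
  0 < q < 1 -> (forall n : nat, g n <= C * q ^+ n) ->
  (forall n : nat, g (Negz n) <= C * q ^+ n) ->
  (\esum_(j in [set: int]) (g j)%:E < +oo)%E.
Proof.
move=> g0 /andP[q0 q1] gp gn.
have C0 : 0 <= C by have := gp 0%N; rewrite expr0 mulr1; apply: le_trans.
have fin (e : nat -> int) : (forall n, g (e n) <= C * q ^+ n) -> injective e ->
    (\esum_(j in range e) (g j)%:E < +oo)%E.
  move=> ge inje; rewrite esum_image; last by move=> x y _ _; exact: inje.
  rewrite -nneseries_esumT; last by move=> n; rewrite lee_fin.
  apply: (@le_lt_trans _ _ (C / (1 - q))%:E); last exact: ltry.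
  apply: lime_le; first by apply: is_cvg_nneseries => n _ _; rewrite lee_fin.
  apply: nearW => n; rewrite sumEFin lee_fin.
  apply: (@le_trans _ _ (\sum_(0 <= i < n) C * q ^+ i)); first exact: ler_sum.
  rewrite -mulr_sumr ler_wpM2l// big_mkord.
  rewrite -div1r ler_pdivlMr; last lra.
  have := subrX1 q n => h.
  have : 0 <= q ^+ n by rewrite exprn_ge0// ltW.
  have h' : (1 - q) * (\sum_(i < n) q ^+ i) = 1 - q ^+ n by rewrite -opprB mulNr -h opprB.
  by rewrite mulrC h'; lra.
rewrite (esumID (range Posz)); last by move=> j _; rewrite lee_fin.
rewrite lte_add_pinfty//.
  by rewrite setTI; apply: fin => // x y [].
apply: (@le_lt_trans _ _ (\esum_(j in range Negz) (g j)%:E)%E); last first.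
  by apply: fin => // x y [].
rewrite setTI (_ : ~` range Posz = range Negz)//.
by apply/seteqP; split=> [[n|n]|_ [n _ <-]] //=; [case; exists n | exists n | case=> m _].
Qed.

Let twoH_gt1 : 1 < 2 * H. Proof. by have := H_gt; lra. Qed.

Let expX_powR (x r : R) n : 0 <= x -> (x ^+ n) `^ r = (x `^ r) ^+ n.
Proof.
by move=> x0; rewrite -powR_mulrn// powRAC powR_mulrn// powR_ge0.
Qed.

Let powRD_gt0 (x r s : R) : 0 < x -> x `^ (r + s) = x `^ r * x `^ s.
Proof. by move=> x0; rewrite powRD//; apply/implyP => _; rewrite gt_eqF. Qed.

Let powR_a_lt1 (r : R) : 0 < r -> 0 < a `^ r < 1.
Proof.
move=> r0; rewrite powR_gt0//=.
have := gt0_ltr_powR r0 _ _ a_lt1; rewrite powR1; apply.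
by rewrite nnegrE ltW.
by rewrite nnegrE.
Qed.

(** For [j >= 0] the quadratic bound on [expR_rem] gives ratio [a^(2 - 2H)]; for [j < 0] the linear
    bound gives ratio [a^(2H - 1)]. Both are below 1 since [1/2 < H < 1]. *)
Lemma osc_variogram_fin (t : R) : 0 <= t ->
  (\esum_(j in [set: int]) (term t j)%:E < +oo)%E.
Proof.
move=> t0; have b0 := ltW b_gt0; have a0 := ltW a_gt0.
set q1 := a `^ (2 - 2 * H); set q2 := a `^ (2 * H - 1).
have /andP[q10 q11] : 0 < q1 < 1 by apply: powR_a_lt1; have := H_lt1; lra.
have /andP[q20 q21] : 0 < q2 < 1 by apply: powR_a_lt1; have := H_gt; lra.
pose q := Num.max q1 q2.
have q0 : 0 <= q by rewrite le_max ltW.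
pose C1 := b `^ (2 - 2 * H) * t ^+ 2; pose C2 := b `^ (1 - 2 * H) * t.
have C10 : 0 <= C1 by rewrite mulr_ge0 ?powR_ge0 ?sqr_ge0.
have C20 : 0 <= C2 by rewrite mulr_ge0 ?powR_ge0.
apply: (@esum_int_geometric_lty _ q (C1 + C2)) => //.
- by rewrite lt_max q10/= gt_max q11.
- move=> n; apply: (@le_trans _ _ (C1 * q1 ^+ n)); last first.
    by rewrite ler_pM ?lerDl ?exprn_ge0 ?(ltW q10)// lerXn2r ?nnegrE ?(ltW q10)// le_max lexx.
  have l0 := scale_gt0 n.
  have := expR_rem_le_sqr (mulr_ge0 (ltW l0) t0) => h.
  apply: le_trans (ler_wpM2l (powR_ge0 _ _) h) _.
  rewrite exprMn mulrA -[X in _ * X * _](powR_mulrn 2 (ltW l0)) -powRD_gt0//.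
  rewrite -exprnP powRM ?exprn_ge0// expX_powR// addrC /C1 /q1.
  by rewrite mulrAC.
- move=> n; apply: (@le_trans _ _ (C2 * q2 ^+ n)); last first.
    by rewrite ler_pM ?lerDr ?exprn_ge0 ?(ltW q20)// lerXn2r ?nnegrE ?(ltW q20)// le_max lexx orbT.
  have l0 := scale_gt0 (Negz n).
  have := expR_rem_le (mulr_ge0 (ltW l0) t0) => h.
  apply: le_trans (ler_wpM2l (powR_ge0 _ _) h) _.
  rewrite mulrA -[X in _ * X * t](powRr1 (ltW l0)) -powRD_gt0//.
  rewrite NegzE -exprnN powRM ?invr_ge0 ?exprn_ge0//.
  rewrite -powR_inv1 ?exprn_ge0// -powRrM expX_powR//.
  rewrite (_ : -1 * (- (2 * H) + 1) = 2 * H - 1); last by ring.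
  (* [Negz n] is [- (n + 1)], so the exponent is [n.+1]; the extra factor [q2 <= 1] is dropped. *)
  rewrite -/q2 addrC /C2 [leLHS](_ : _ = C2 * q2 ^+ n.+1); last by rewrite /C2; ring.
  by rewrite ler_wpM2l// exprS ler_piMl ?exprn_ge0 ?ltW.
Qed.

Lemma osc_variogramE (t : R) : 0 <= t ->
  (\esum_(j in [set: int]) (term t j)%:E)%E = (f t)%:E.
Proof.
move=> t0; rewrite /f /osc_h; case: eqP => [->|/eqP tn0].
  rewrite mulr0 esum1// => j _; congr EFin.
  by rewrite /term /expR_rem mulr0 oppr0 expR0 subrr add0r mulr0.
have {tn0}t0 : 0 < t by rewrite lt0r tn0.
have th0 : 0 < t `^ (2 * H) by exact: powR_gt0.
(* Multiplying by [t^(2H)] cancels [t] from the negative power, so the weights in [term] no longer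
   depend on [t]. *)
have e j : ((term t j)%:E = (t `^ (2 * H))%:E *
  ((b * a ^ j * t) `^ (- (2 * H)) * (expR (- (b * a ^ j * t)) - 1 + b * a ^ j * t))%:E)%E.
  rewrite -EFinM; congr EFin; rewrite /term mulrA; congr (_ * _).
  rewrite [in RHS]powRM ?(ltW (scale_gt0 _)) ?ltW// mulrCA -powRD_gt0// subrr powRr0 mulr1//.
have := osc_variogram_fin (ltW t0).
rewrite (eq_esum (fun j _ => e j)).
rewrite esumZl//; last by move=> j; rewrite lee_fin mulr_ge0 ?powR_ge0// expR_rem_ge0.
set S := esum _ _ => h.
have S0 : (0 <= S)%E.
  by apply: esum_ge0 => j _; rewrite lee_fin mulr_ge0 ?powR_ge0// expR_rem_ge0.
rewrite EFinM fineK// ge0_fin_numE//.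
(* A positive multiple of the sum is finite, hence so is the sum, and [fine] in [osc_h] is
   harmless. *)
move: S0 h; case: (S) => [r _ _|_|]//; first exact: ltry.
by rewrite gt0_muley ?lte_fin// ltxx.
Qed.

Lemma osc_variogram_le (s t : R) : 0 <= s -> s <= t -> f s <= f t.
Proof.
move=> s0 st; have t0 := le_trans s0 st.
rewrite -lee_fin -!osc_variogramE//; apply: le_esum => j _.
rewrite lee_fin ler_wpM2l ?powR_ge0//; have := scale_gt0 j => h.
by apply: le_expR_rem; [rewrite mulr_ge0// ltW | rewrite ler_pM2l].
Qed.

Lemma osc_variogram_gt0 (t : R) : 0 < t -> 0 < f t.
Proof.
move=> t0; rewrite -lte_fin -osc_variogramE ?ltW//.
apply: (@lt_le_trans _ _ (term t 0)%:E).
  by rewrite lte_fin mulr_gt0 ?powR_gt0// expR_rem_gt0// mulr_gt0.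
apply: esum_ge; exists [set (0 : int)]; first by split.
by rewrite fsbig_set1.
Qed.

Lemma osc_variogram0 : f 0 = 0.
Proof. by rewrite /f powR0 ?mul0r// gt_eqF// (lt_trans ltr01). Qed.

Lemma osc_variogram_ge0 (t : R) : 0 <= t -> 0 <= f t.
Proof. by move=> t0; rewrite -osc_variogram0 osc_variogram_le. Qed.

(** Replacing [t] by [a * t] shifts the index [j] by one; the weights then change by the common
    factor [a^(2H)]. *)
Lemma osc_variogram_scale (t : R) : 0 <= t -> f (a * t) = a `^ (2 * H) * f t.
Proof.
move=> t0; have a0 := ltW a_gt0; apply: EFin_inj.
have sb : set_bij [set: int] [set: int] (fun j : int => j - 1).
  split=> [//|x y _ _|x _]; [exact: addIr | by exists (x + 1); rewrite ?addrK].
rewrite -osc_variogramE ?mulr_ge0// (@reindex_esum _ _ _ _ _ _ _ sb) EFinM -osc_variogramE//.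
rewrite -esumZl ?powR_gt0//; last by move=> j; rewrite lee_fin.
apply: eq_esum => j _; rewrite -EFinM; congr EFin; rewrite /term.
have ej : b * a ^ j = a * (b * a ^ (j - 1)).
  by rewrite -[in LHS](subrK 1 j) expfzDr ?gt_eqF// expr1z; ring.
rewrite [in RHS]ej [in RHS]powRM ?(ltW (scale_gt0 _))//.
have aa : a `^ (2 * H) * a `^ (- (2 * H)) = 1 by rewrite -powRD_gt0// subrr powRr0.
rewrite -[LHS]mul1r -[X in X * _ = _]aa.
rewrite (_ : _ * (a * t) = a * (b * a ^ (j - 1)) * t); last by ring.
by ring.
Qed.

Lemma osc_variogram_diff2_ge0 (u e : R) : 0 <= e -> e <= u ->
  2 * f u <= f (u + e) + f (u - e).
Proof.
move=> e0 eu; have u0 := le_trans e0 eu.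
have [u1 u2] : 0 <= u + e /\ 0 <= u - e by split; lra.
rewrite -lee_fin EFinD [X in (X <= _)%E]EFinM -!osc_variogramE//.
rewrite -esumD; [|by move=> j _; rewrite lee_fin|by move=> j _; rewrite lee_fin].
rewrite -esumZl//; last by move=> j; rewrite lee_fin.
apply: le_esum => j _; rewrite -EFinM -EFinD lee_fin /term mulrCA -mulrDr.
rewrite ler_wpM2l ?powR_ge0// [b * _ * (u + e)]mulrDr [b * _ * (u - e)]mulrBr.
exact: expR_rem_diff2_ge0.
Qed.

(** The ratio [e / u] does not change when both arguments are multiplied by [b * a ^ j], so a single
    factor serves all terms and the inequality passes to the sum. *)
Lemma osc_variogram_diff2_le (u e : R) : 0 < e -> 2 * e <= u ->
  f (u + e) + f (u - e) <= (2 + 8 * (e / u) ^+ 2) * f u.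
Proof.
move=> e0 eu; have u0 : 0 < u by lra.
have c0 : 0 < 2 + 8 * (e / u) ^+ 2 by have := sqr_ge0 (e / u); lra.
have [u1 u2 u3] : [/\ 0 <= u, 0 <= u + e & 0 <= u - e] by split; lra.
rewrite -lee_fin EFinD [X in (_ <= X)%E]EFinM -!osc_variogramE//.
rewrite -esumD; [|by move=> j _; rewrite lee_fin|by move=> j _; rewrite lee_fin].
rewrite -esumZl//; last by move=> j; rewrite lee_fin.
apply: le_esum => j _; rewrite -EFinM -EFinD lee_fin /term mulrCA -mulrDr.
rewrite ler_wpM2l ?powR_ge0// [b * _ * (u + e)]mulrDr [b * _ * (u - e)]mulrBr; have l0 := scale_gt0 j.
have -> : e / u = (b * a ^ j * e) / (b * a ^ j * u).
  by rewrite invfM mulrACA divff ?mul1r// gt_eqF.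
by apply: expR_rem_diff2_le; [rewrite mulr_gt0|rewrite mulr_ge0// ltW|rewrite mulrCA ler_pM2l].
Qed.

(** Multiply [u] by [a] until it falls below [e]. Each step costs exactly the scaling factor, and
    the last one, which may overshoot, accounts for the constant [a^(-2H)]. *)
Lemma osc_variogram_growth (e u : R) : 0 < e -> e <= u ->
  f u <= a `^ (- (2 * H)) * (u / e) `^ (2 * H) * f e.
Proof.
move=> e0 eu; have H0 : 0 < 2 * H by exact: lt_trans twoH_gt1.
have ap0 : 0 < a `^ (2 * H) by exact: powR_gt0.
have [n an] : exists n, a ^+ n * u < e.
  have : a ^+ n @[n --> \oo] --> 0 by apply: cvg_expr; rewrite gtr0_norm.
  move=> /cvgr0Pnorm_lt/(_ (e / u)).
  have u0 : 0 < u by exact: lt_le_trans eu.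
  rewrite divr_gt0// => /(_ isT)[n _ /(_ n (leqnn n))/=].
  by rewrite ger0_norm ?exprn_ge0 ?ltW// ltr_pdivlMr// => ?; exists n.
elim: n u eu an => [u eu|n IH u eu an].
  by rewrite expr0 mul1r ltNge eu.
have u0 : 0 < u by exact: lt_le_trans eu.
have fu : f u = a `^ (- (2 * H)) * f (a * u).
  by rewrite osc_variogram_scale ?ltW// powRN mulKf// gt_eqF.
rewrite {1}fu -mulrA ler_wpM2l ?powR_ge0//.
(* If the next step passes below [e], monotonicity and [u / e >= 1] conclude; otherwise the constant
   of the induction hypothesis cancels against [a^(2H)]. *)
have [aue|eau] := ltP (a * u) e.
  apply: le_trans (osc_variogram_le _ (ltW aue)) _; first by rewrite mulr_ge0// ltW.
  rewrite ler_peMl ?osc_variogram_ge0 ?(ltW e0)//.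
  by rewrite -[leLHS](powRr0 (u / e)) ler_powR ?(ltW H0)// ler_pdivlMr// mul1r.
apply: le_trans (IH _ eau _) _; first by rewrite mulrA -exprSr.
rewrite ler_wpM2r ?osc_variogram_ge0 ?(ltW e0)// -mulrA.
rewrite powRM ?divr_ge0 ?(ltW a_gt0) ?(ltW u0) ?(ltW e0)// mulrA -powRD_gt0//.
by rewrite addNr powRr0 mul1r.
Qed.

End osc.
End variogram.

(** * Isserlis' formula and second moments of quadratic sums *)

Section gaussian_products.
Context {R : realType} d (Omega : measurableType d) (P : probability Omega R).
Local Notation integrable f := (P.-integrable [set: Omega] (EFin \o f)).

Lemma eq_integrable_EFin (f g : Omega -> R) : f =1 g -> integrable f -> integrable g.
Proof. by move=> fg; apply: eq_integrable => //= w _; rewrite fg. Qed.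

Lemma integrable_EFin_sum (n : nat) (f : nat -> Omega -> R) :
  (forall i, (i < n)%N -> integrable (f i)) ->
  integrable (fun w => \sum_(i < n) f i w).
Proof.
elim: n => [_|n IH h].
  by apply: eq_integrable_EFin (integrable_EFin_cst P 0) => w; rewrite big_ord0.
have hn := integrable_EFinD (IH (fun i ni => h i (ltnW ni))) (h n (ltnSn n)).
by apply: eq_integrable_EFin hn => w; rewrite big_ord_recr.
Qed.

Lemma Rintegral_sum (n : nat) (f : nat -> Omega -> R) :
  (forall i, (i < n)%N -> integrable (f i)) ->
  \int[P]_w (\sum_(i < n) f i w) = \sum_(i < n) \int[P]_w f i w.
Proof.
elim: n => [_|n IH h].
  by under eq_Rintegral do rewrite big_ord0; rewrite Rintegral_prob_cst big_ord0.
under eq_Rintegral do rewrite big_ord_recr/=.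
rewrite RintegralD//; last 2 first.
- by apply: integrable_EFin_sum => i ni; exact/h/ltnW.
- exact: h.
by rewrite IH ?big_ord_recr// => i ni; exact/h/ltnW.
Qed.

Definition centered_gaussian_rv (Y : Omega -> R) := gaussian_rv P Y /\ 'E_P[Y]%E = 0%E.

Lemma centered_gaussian_rv4 (Y : Omega -> R) : centered_gaussian_rv Y ->
  [/\ integrable Y, integrable (fun w => Y w ^+ 2), integrable (fun w => Y w ^+ 4) &
    \int[P]_w (Y w ^+ 4) = 3 * (\int[P]_w (Y w ^+ 2)) ^+ 2].
Proof.
move=> [gY EY]; have [mY _] := gY.
have [s [Y2 Y4]] := centered_gaussian_rv_moments gY EY.
have i2 : integrable (fun w => Y w ^+ 2).
  by apply: ge0_integrable_EFin Y2 => [|w]; [exact: measurable_funX|exact: sqr_ge0].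
have i4 : integrable (fun w => Y w ^+ 4).
  by apply: ge0_integrable_EFin Y4 => [|w]; [exact: measurable_funX|exact: exprn_even_ge0].
split=> //; last by rewrite /Rintegral Y2 Y4/=; ring.
apply: le_integrable (integrable_EFinD (integrable_EFin_cst P 1) i2) => //.
  exact/measurable_EFinP.
move=> w _ /=; rewrite lee_fin [leRHS]ger0_norm; last by rewrite addr_ge0// sqr_ge0.
rewrite -real_normK ?num_real//; have := normr_ge0 (Y w); nra.
Qed.

(* Polarization: [12 Y^2 Z^2 = (Y + Z)^4 + (Y - Z)^4 - 2 Y^4 - 2 Z^4]. *)
Lemma gaussian_isserlis (Y Z : Omega -> R) :
  centered_gaussian_rv Y -> centered_gaussian_rv Z ->
  centered_gaussian_rv (fun w => Y w + Z w) -> centered_gaussian_rv (fun w => Y w - Z w) ->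
  [/\ integrable (fun w => Y w * Z w), integrable (fun w => Y w ^+ 2 * Z w ^+ 2) &
   \int[P]_w (Y w ^+ 2 * Z w ^+ 2) =
   (\int[P]_w (Y w ^+ 2)) * (\int[P]_w (Z w ^+ 2)) + 2 * (\int[P]_w (Y w * Z w)) ^+ 2].
Proof.
move=> /centered_gaussian_rv4[_ Y2 Y4 eY] /centered_gaussian_rv4[_ Z2 Z4 eZ].
move=> /centered_gaussian_rv4[_ W2 W4 eW] /centered_gaussian_rv4[_ V2 V4 eV].
have iYZ : integrable (fun w => Y w * Z w).
  apply: eq_integrable_EFin (integrable_EFinZ 4^-1 (integrable_EFinB W2 V2)) => w.
  by field.
have iYZ2 : integrable (fun w => Y w ^+ 2 * Z w ^+ 2).
  apply: eq_integrable_EFin (integrable_EFinZ 12^-1 (integrable_EFinB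
    (integrable_EFinD W4 V4) (integrable_EFinZ 2 (integrable_EFinD Y4 Z4)))) => w.
  by field.
split=> //.
have hW : \int[P]_w ((Y w + Z w) ^+ 2) =
    \int[P]_w (Y w ^+ 2) + (2 * \int[P]_w (Y w * Z w) + \int[P]_w (Z w ^+ 2)).
  rewrite -RintegralZl// -RintegralD//; last exact: integrable_EFinZ.
  rewrite -RintegralD//; last exact: integrable_EFinD (integrable_EFinZ 2 iYZ) Z2.
  by apply: eq_Rintegral => w _; ring.
have hV : \int[P]_w ((Y w - Z w) ^+ 2) =
    \int[P]_w (Y w ^+ 2) + (- 2 * \int[P]_w (Y w * Z w) + \int[P]_w (Z w ^+ 2)).
  rewrite -RintegralZl// -RintegralD//; last exact: integrable_EFinZ.
  rewrite -RintegralD//; last exact: integrable_EFinD (integrable_EFinZ _ iYZ) Z2.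
  by apply: eq_Rintegral => w _; ring.
have h4 : \int[P]_w ((Y w + Z w) ^+ 4) + \int[P]_w ((Y w - Z w) ^+ 4) =
    12 * \int[P]_w (Y w ^+ 2 * Z w ^+ 2) +
    (2 * \int[P]_w (Y w ^+ 4) + 2 * \int[P]_w (Z w ^+ 4)).
  rewrite -!RintegralZl// -!RintegralD//; last 4 first.
  - exact: integrable_EFinZ.
  - exact: integrable_EFinD (integrable_EFinZ _ Y4) (integrable_EFinZ _ Z4).
  - exact: integrable_EFinZ.
  - exact: integrable_EFinZ.
  by apply: eq_Rintegral => w _; ring.
rewrite eW eV hW hV eY eZ in h4.
set A := (X in _ = X); set B := (X in X = _).
have : 12 * B = 12 * A by rewrite /A /B; lra.
by move=> /mulfI; apply.
Qed.

Context (X : R -> Omega -> R) (K : R -> R -> R).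
Hypothesis Xgauss : centered_gaussian_process P X K.

(** Four times are what a linear combination of two increments involves. *)
Lemma centered_gaussian_process4 (t1 t2 t3 t4 c1 c2 c3 c4 : R) :
  0 <= t1 -> 0 <= t2 -> 0 <= t3 -> 0 <= t4 ->
  centered_gaussian_rv
    (fun w => c1 * X t1 w + c2 * X t2 w + c3 * X t3 w + c4 * X t4 w).
Proof.
move=> t10 t20 t30 t40; have [gX EX _] := Xgauss.
have gX1 t : 0 <= t -> centered_gaussian_rv (X t).
  move=> t0; split; last exact: EX.
  have := gX 1%N (fun=> t) (fun=> 1) (fun=> t0).
  rewrite (_ : (fun w => _) = X t)//; apply/funext => w.
  by rewrite big_ord1 mul1r.
have iX t : 0 <= t -> integrable (X t).
  by move=> /gX1/centered_gaussian_rv4[].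
split.
  have := gX 4%N (fun i => [:: t1; t2; t3; t4]`_i) (fun i => [:: c1; c2; c3; c4]`_i).
  rewrite (_ : (fun w => _) =
    (fun w => c1 * X t1 w + c2 * X t2 w + c3 * X t3 w + c4 * X t4 w)).
    by apply=> -[[|[|[|[|//]]]]].
  by apply/funext => w; rewrite !big_ord_recl big_ord0/= addr0 !addrA.
have E0 t : 0 <= t -> \int[P]_w X t w = 0.
  by move=> t0; have := EX t t0; rewrite unlock /Rintegral => ->.
have iS : integrable (fun w => c1 * X t1 w + c2 * X t2 w + c3 * X t3 w + c4 * X t4 w).
  by do 3 (apply: integrable_EFinD; last exact/integrable_EFinZ/iX); exact/integrable_EFinZ/iX.
rewrite unlock -[LHS]fineK; last exact: integrable_fin_num iS.
congr EFin; rewrite -/(Rintegral _ _ _).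
rewrite !RintegralD//; do ?[exact/integrable_EFinZ/iX].
- by rewrite !RintegralZl ?E0 ?mulr0 ?addr0//; exact: iX.
- by apply: integrable_EFinD; exact/integrable_EFinZ/iX.
- by do 2 (apply: integrable_EFinD; last exact/integrable_EFinZ/iX); exact/integrable_EFinZ/iX.
Qed.

Definition increment (e t : R) (w : Omega) := X (t + e) w - X t w.

Definition increment_cov (e s t : R) :=
  K (s + e) (t + e) - K (s + e) t - K s (t + e) + K s t.

Lemma increment_gaussian (e s t c1 c2 : R) : 0 <= e -> 0 <= s -> 0 <= t ->
  centered_gaussian_rv (fun w => c1 * increment e s w + c2 * increment e t w).
Proof.
move=> e0 s0 t0.
have := @centered_gaussian_process4 (s + e) s (t + e) t c1 (- c1) c2 (- c2)
  (addr_ge0 s0 e0) s0 (addr_ge0 t0 e0) t0.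
by congr (centered_gaussian_rv _); apply/funext => w; rewrite /increment; ring.
Qed.

Lemma increment_isserlis (e s t : R) : 0 <= e -> 0 <= s -> 0 <= t ->
  [/\ integrable (fun w => increment e s w ^+ 2),
   integrable (fun w => increment e s w * increment e t w),
   integrable (fun w => increment e s w ^+ 2 * increment e t w ^+ 2) &
   \int[P]_w (increment e s w ^+ 2 * increment e t w ^+ 2) =
   (\int[P]_w (increment e s w ^+ 2)) * (\int[P]_w (increment e t w ^+ 2)) +
     2 * (\int[P]_w (increment e s w * increment e t w)) ^+ 2].
Proof.
move=> e0 s0 t0.
have g c1 c2 (U : Omega -> R) :
    (fun w => c1 * increment e s w + c2 * increment e t w) =1 U -> centered_gaussian_rv U.
  by move=> /funext <-; exact: increment_gaussian.
have gs : centered_gaussian_rv (increment e s) by apply: (g 1 0) => w; ring.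
have gt : centered_gaussian_rv (increment e t) by apply: (g 0 1) => w; ring.
have gD : centered_gaussian_rv (fun w => increment e s w + increment e t w).
  by apply: (g 1 1) => w; ring.
have gB : centered_gaussian_rv (fun w => increment e s w - increment e t w).
  by apply: (g 1 (-1)) => w; ring.
have [_ s2 _ _] := centered_gaussian_rv4 gs.
by have [] := gaussian_isserlis gs gt gD gB.
Qed.

Lemma Rintegral_increment (e s t : R) : 0 <= e -> 0 <= s -> 0 <= t ->
  \int[P]_w (increment e s w * increment e t w) = increment_cov e s t.
Proof.
move=> e0 s0 t0; have [_ _ EXX] := Xgauss.
have iXX u v : 0 <= u -> 0 <= v -> integrable (fun w => X u w * X v w).
  move=> u0 v0.
  have g c1 c2 (U : Omega -> R) :
      (fun w => c1 * X u w + c2 * X v w) =1 U -> centered_gaussian_rv U.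
    move=> /funext <-.
    have := centered_gaussian_process4 c1 c2 0 0 u0 v0 u0 v0.
    by congr (centered_gaussian_rv _); apply/funext => w; ring.
  have [] := @gaussian_isserlis (X u) (X v) => //.
  - by apply: (g 1 0) => w; ring.
  - by apply: (g 0 1) => w; ring.
  - by apply: (g 1 1) => w; ring.
  - by apply: (g 1 (-1)) => w; ring.
have EX u v : 0 <= u -> 0 <= v -> \int[P]_w (X u w * X v w) = K u v.
  by move=> u0 v0; have := EXX u v u0 v0; rewrite unlock /Rintegral => ->.
have se0 := addr_ge0 s0 e0; have te0 := addr_ge0 t0 e0.
rewrite /increment_cov -!EX//.
rewrite -RintegralB; [|by []|exact: iXX|exact: iXX].
rewrite -RintegralB; [|by []|by apply: integrable_EFinB; exact: iXX|exact: iXX].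
rewrite -RintegralD; [|by []| |exact: iXX].
  by apply: eq_Rintegral => w _; rewrite /increment; ring.
by apply: integrable_EFinB; [apply: integrable_EFinB|]; exact: iXX.
Qed.

Lemma increment_cov_ge0 (e s : R) : 0 <= e -> 0 <= s -> 0 <= increment_cov e s s.
Proof.
move=> e0 s0; rewrite -Rintegral_increment//.
by apply: Rintegral_ge0 => w _; rewrite -expr2 sqr_ge0.
Qed.

(** The second moments of the sum and of the difference of the two increments are nonnegative. This
    arithmetic-mean form of Cauchy-Schwarz suffices to bound correlations by 1. *)
Lemma increment_cov_le (e s t : R) : 0 <= e -> 0 <= s -> 0 <= t ->
  `|increment_cov e s t| <= (increment_cov e s s + increment_cov e t t) / 2.
Proof.
move=> e0 s0 t0.
have [s2 st _ _] := increment_isserlis e0 s0 t0.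
have [t2 _ _ _] := increment_isserlis e0 t0 s0.
rewrite -!Rintegral_increment//.
have ss : \int[P]_w (increment e s w * increment e s w) = \int[P]_w (increment e s w ^+ 2) by [].
have tt : \int[P]_w (increment e t w * increment e t w) = \int[P]_w (increment e t w ^+ 2) by [].
have pos c : 0 <= \int[P]_w (increment e s w ^+ 2) + (2 * c * \int[P]_w (increment e s w * increment e t w) +
    c ^+ 2 * \int[P]_w (increment e t w ^+ 2)).
  rewrite -!RintegralZl// -RintegralD; [|by []|exact: integrable_EFinZ|exact: integrable_EFinZ].
  rewrite -RintegralD//; last by apply: integrable_EFinD; exact: integrable_EFinZ.
  apply: Rintegral_ge0 => w _.
  rewrite [leRHS](_ : _ = (increment e s w + c * increment e t w) ^+ 2) ?sqr_ge0//; ring.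
rewrite ss tt; have := pos 1; have := pos (-1).
by rewrite ler_norml => h1 h2; apply/andP; split; lra.
Qed.

Section quadratic_sums.
Context (F e eta : R) (N : nat).
Hypotheses (F0 : 0 < F) (e0 : 0 <= e) (eta0 : 0 <= eta).

Definition quadratic_sum (w : Omega) :=
  eta * \sum_(i < N) increment e (i%:R * eta) w ^+ 2 / F.

(** Expand the square over pairs of [Z i = Y i ^+ 2 / F - 1]. Isserlis' formula makes the mean of
    [Z i * Z j] a product of relative biases plus twice a squared correlation. *)
Lemma Rintegral_quadratic_sum :
  integrable (fun w => (quadratic_sum w - eta * N%:R) ^+ 2) /\
  \int[P]_w ((quadratic_sum w - eta * N%:R) ^+ 2) =
  eta ^+ 2 * \sum_(i < N) \sum_(j < N)
   ((increment_cov e (i%:R * eta) (i%:R * eta) / F - 1) *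
    (increment_cov e (j%:R * eta) (j%:R * eta) / F - 1) +
    2 * (increment_cov e (i%:R * eta) (j%:R * eta) / F) ^+ 2).
Proof.
pose Y (i : nat) w := increment e (i%:R * eta) w.
pose Z (i : nat) w := Y i w ^+ 2 / F - 1.
have t0 (i : nat) : 0 <= i%:R * eta by rewrite mulr_ge0.
have ZZ i j w : Z i w * Z j w = F ^- 2 * (Y i w ^+ 2 * Y j w ^+ 2) +
    (- F^-1 * (Y i w ^+ 2) + (- F^-1 * (Y j w ^+ 2) + 1)).
  by rewrite /Z; field; rewrite gt_eqF.
have iZZ i j : integrable (fun w => Z i w * Z j w) /\
   \int[P]_w (Z i w * Z j w) =
   (increment_cov e (i%:R * eta) (i%:R * eta) / F - 1) *
    (increment_cov e (j%:R * eta) (j%:R * eta) / F - 1) +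
    2 * (increment_cov e (i%:R * eta) (j%:R * eta) / F) ^+ 2.
  have [i2 _ ij2 Eij] := increment_isserlis e0 (t0 i) (t0 j).
  have [j2 _ _ _] := increment_isserlis e0 (t0 j) (t0 i).
  have c1 := integrable_EFin_cst P 1.
  have h1 := integrable_EFinD (integrable_EFinZ (- F^-1) j2) c1.
  have h2 := integrable_EFinD (integrable_EFinZ (- F^-1) i2) h1.
  have h3 := integrable_EFinD (integrable_EFinZ (F ^- 2) ij2) h2.
  split; first by apply: eq_integrable_EFin h3 => w; rewrite ZZ.
  under eq_Rintegral do rewrite ZZ.
  rewrite RintegralD//; last exact: integrable_EFinZ.
  rewrite RintegralD//; last exact: integrable_EFinZ.
  rewrite RintegralD//; last exact: integrable_EFinZ.
  rewrite !RintegralZl// Rintegral_prob_cst Eij -!Rintegral_increment//.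
  rewrite -/(Y i) -/(Y j); field; rewrite gt_eqF//.
have SE w : (quadratic_sum w - eta * N%:R) ^+ 2 =
    eta ^+ 2 * \sum_(i < N) \sum_(j < N) Z i w * Z j w.
  have -> : quadratic_sum w - eta * N%:R = eta * \sum_(i < N) Z i w.
    by rewrite /Z sumrB sumr_const card_ord /quadratic_sum mulrBr.
  rewrite exprMn; congr (_ * _); rewrite expr2 mulr_suml.
  by apply: eq_bigr => i _; rewrite mulr_sumr.
have is1 i : integrable (fun w => \sum_(j < N) Z i w * Z j w).
  by apply: (@integrable_EFin_sum _ (fun j w => Z i w * Z j w)) => j _; have [] := iZZ i j.
have is2 : integrable (fun w => \sum_(i < N) \sum_(j < N) Z i w * Z j w).
  exact: (@integrable_EFin_sum _ (fun i w => \sum_(j < N) Z i w * Z j w)).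
split; first by apply: eq_integrable_EFin (integrable_EFinZ _ is2) => w; rewrite SE.
under eq_Rintegral do rewrite SE.
rewrite RintegralZl//; congr (_ * _).
rewrite (@Rintegral_sum _ (fun i w => \sum_(j < N) Z i w * Z j w))//.
apply: eq_bigr => i _; rewrite (@Rintegral_sum _ (fun j w => Z i w * Z j w)).
  by apply: eq_bigr => j _; have [] := iZZ i j.
by move=> j _; have [] := iZZ i j.
Qed.

End quadratic_sums.
End gaussian_products.

(** * Sums over lags and sums of negative powers *)

Section finite_sums.
Context {R : realType}.

(** With truncated subtraction [(i - j) + (j - i)] is the distance of [i] and [j]; each distance is
    taken by at most [2 * N] ordered pairs. *)
Lemma sum_dist_le (g : nat -> R) (N : nat) : (forall k, 0 <= g k) ->
  \sum_(i < N) \sum_(j < N) g ((i - j) + (j - i))%N <=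
  2 * N%:R * \sum_(k < N) g k.
Proof.
move=> g0; elim: N => [|N IH]; first by rewrite !big_ord0 mulr0.
have rev : \sum_(i < N) g (N - i)%N = \sum_(i < N) g i.+1.
  rewrite (reindex_inj rev_ord_inj)/=; apply: eq_bigr => i _; congr g.
  by have := ltn_ord i; lia.
set S := \sum_(k < N) g k in IH.
have SN : \sum_(k < N.+1) g k = S + g N by rewrite big_ord_recr.
have SN' : \sum_(k < N.+1) g k = g 0%N + \sum_(i < N) g i.+1 by rewrite big_ord_recl.
rewrite big_ord_recr/=.
under eq_bigr do rewrite big_ord_recr/=.
rewrite big_split/= big_ord_recr/=.
have -> : \sum_(i < N) g (i - N + (N - i))%N = \sum_(i < N) g (N - i)%N.
  by apply: eq_bigr => i _; congr g; have := ltn_ord i; lia.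
have -> : \sum_(i < N) g (N - i + (i - N))%N = \sum_(i < N) g (N - i)%N.
  by apply: eq_bigr => i _; congr g; have := ltn_ord i; lia.
rewrite subnn addn0 rev -natr1.
have g00 := g0 0%N; have gN := g0 N.
have N0 : (0 : R) <= N%:R by [].
set U := \sum_(i < N) g i.+1 in SN' *.
rewrite SN in SN' *.
have : 0 <= N%:R * g N by rewrite mulr_ge0.
set NR := N%:R in IH *; rewrite -/S in SN SN' *.
nra.
Qed.

(* Weighted AM-GM, applied to [k^(1 - delta) * (k + 1)^delta]. *)
Lemma powR_telescope_le (delta : R) (k : nat) : 0 < delta -> delta < 1 ->
  (1 - delta) * k.+1%:R `^ (- delta) <= k.+1%:R `^ (1 - delta) - k%:R `^ (1 - delta).
Proof.
move=> d0 d1.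
have k1 : (0 : R) < k.+1%:R by rewrite ltr0n.
have := @conjugate_powR R (k%:R `^ (1 - delta)) (k.+1%:R `^ delta) (1 - delta)^-1 delta^-1
  (powR_ge0 _ _) (powR_ge0 _ _).
have dd0 : 0 < 1 - delta by lra.
rewrite !invr_gt0 => /(_ dd0 d0); rewrite !invrK subrK => /(_ erefl).
rewrite -!powRrM !divff ?gt_eqF// !powRr1// => h.
have e1 : k.+1%:R `^ (1 - delta) = k.+1%:R * k.+1%:R `^ (- delta) :> R.
  by rewrite powRD ?powRr1 ?ltW//; apply/implyP => _; rewrite gt_eqF.
have p0 : (0 : R) < k.+1%:R `^ (- delta) by exact: powR_gt0.
have h2 : k%:R `^ (1 - delta) <= (k%:R * (1 - delta) + k.+1%:R * delta) * k.+1%:R `^ (- delta) :> R.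
  have -> : k%:R `^ (1 - delta) = k%:R `^ (1 - delta) * k.+1%:R `^ delta * k.+1%:R `^ (- delta) :> R.
    rewrite -mulrA -powRD ?subrr ?powRr0 ?mulr1//.
    by apply/implyP => _; rewrite gt_eqF.
  by rewrite ler_wpM2r// ltW.
rewrite e1; move: h2; rewrite -natr1 => h2; nra.
Qed.

Lemma sum_powRN_le (delta : R) (N : nat) : 0 < delta -> delta < 1 ->
  \sum_(k < N) k.+1%:R `^ (- delta) <= N%:R `^ (1 - delta) / (1 - delta).
Proof.
move=> d0 d1; have dd0 : 0 < 1 - delta by lra.
rewrite ler_pdivlMr//; elim: N => [|N IH].
  by rewrite big_ord0 mul0r powR_ge0.
by rewrite big_ord_recr/= mulrDl; have := powR_telescope_le N d0 d1; lra.
Qed.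

End finite_sums.

(** * Bias and decay of the increment covariances *)

Section covariance_bounds.
Context {R : realType} (a b H : R).
Hypotheses (a_gt0 : 0 < a) (a_lt1 : a < 1) (b_gt0 : 0 < b).
Hypotheses (H_gt : 2^-1 < H) (H_lt1 : H < 1).
Local Notation f := (osc_variogram a b H).

Lemma osc_fbm_covE (s t : R) :
  osc_fbm_cov a b H s t = 2^-1 * (f s + f t - f `|s - t|).
Proof. by []. Qed.

Lemma osc_subfbm_covE (s t : R) :
  osc_subfbm_cov a b H s t = f s + f t - 2^-1 * (f (s + t) + f `|s - t|).
Proof. by []. Qed.

Definition variogram_diff2 (e u : R) := f (u + e) + f (u - e) - 2 * f u.
Local Notation D := variogram_diff2.

(** Half of [8 * a^(-2H)]: the 8 comes from the second-difference bound, the power of [a] from the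
    growth bound, and the half from the factor [2^-1] in the covariances. *)
Definition decay_cst : R := 4 * a `^ (- (2 * H)).

Lemma variogram_diff2_ge0 (e u : R) : 0 <= e -> e <= u -> 0 <= D e u.
Proof.
by move=> e0 eu; have := osc_variogram_diff2_ge0 a_gt0 a_lt1 b_gt0 H_gt H_lt1 e0 eu; rewrite /D; lra.
Qed.

(** The bound [8 * (e / u) ^+ 2 * f u] meets the growth [(u / e)^(2H)], leaving [(e / u)^(2 - 2H)].
    The separate [v] lets second differences at the farther points [2 * s + e] and [s + t + e] be
    measured by [s] and [|s - t|]. *)
Lemma variogram_diff2_le (e u v : R) : 0 < e -> 2 * e <= v -> v <= u ->
  D e u <= 2 * decay_cst * (e / v) `^ (2 - 2 * H) * f e.
Proof.
move=> e0 ev vu; have v0 : 0 < v by lra.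
have u0 : 0 < u by lra.
have eu : 2 * e <= u by lra.
have fe := ltW (osc_variogram_gt0 a_gt0 a_lt1 b_gt0 H_gt H_lt1 e0).
have h1 := osc_variogram_diff2_le a_gt0 a_lt1 b_gt0 H_gt H_lt1 e0 eu.
have eu' : e <= u by lra.
have h2 := osc_variogram_growth a_gt0 a_lt1 b_gt0 H_gt H_lt1 e0 eu'.
apply: (@le_trans _ _ (8 * (e / u) ^+ 2 * f u)); first by rewrite /D; lra.
apply: (@le_trans _ _ (2 * decay_cst * (e / u) `^ (2 - 2 * H) * f e)).
  have : 8 * (e / u) ^+ 2 * f u <= 8 * (e / u) ^+ 2 * (a `^ (- (2 * H)) * (u / e) `^ (2 * H) * f e).
    by rewrite ler_wpM2l// mulr_ge0// sqr_ge0.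
  move=> /le_trans; apply.
  have r0 : 0 < e / u by rewrite divr_gt0.
  have -> : (u / e) `^ (2 * H) = (e / u) `^ (- (2 * H)).
    by rewrite -[u / e]invf_div -(powR_inv1 (ltW r0)) -powRrM mulN1r.
  have -> : (e / u) `^ (2 - 2 * H) = (e / u) ^+ 2 * (e / u) `^ (- (2 * H)).
    rewrite -(powR_mulrn 2 (ltW r0)) -powRD//.
    by apply/implyP => _; rewrite gt_eqF.
  by rewrite /decay_cst [leLHS](_ : _ = 2 * (4 * a `^ (- (2 * H))) *
    ((e / u) ^+ 2 * (e / u) `^ (- (2 * H))) * f e); [|ring].
rewrite ler_wpM2r// ler_wpM2l//; first by rewrite !mulr_ge0// powR_ge0.
by rewrite ge0_ler_powR ?nnegrE ?divr_ge0 ?(ltW e0) ?(ltW v0) ?(ltW u0)//;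
  [have := H_lt1; lra | rewrite ler_pM2l// lef_pV2].
Qed.

Variable (K : R -> R -> R).
Hypothesis K_osc : K = osc_fbm_cov a b H \/ K = osc_subfbm_cov a b H.
Local Notation Q := (increment_cov K).

(** The fractional case is stationary. In the sub-fractional case the terms in [s + t] form a second
    difference centred at [2 * s + e]. *)
Lemma increment_cov_diag (e s : R) : 0 <= e -> 0 <= s ->
  Q e s s = f e \/ Q e s s = f e - 2^-1 * D e (2 * s + e).
Proof.
move=> e0 s0; have f0 := osc_variogram0 a b H_gt.
have ee : `|e| = e by rewrite ger0_norm.
have E1 : s + e - s = e by ring. have E2 : s - (s + e) = - e by ring.
rewrite /increment_cov; case: K_osc => ->; [left|right].
  by rewrite !osc_fbm_covE !subrr E1 E2 normrN !normr0 ee f0; field.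
rewrite !osc_subfbm_covE !subrr E1 E2 normrN !normr0 ee f0 /D.
have -> : s + e + (s + e) = 2 * s + e + e by ring.
have -> : s + e + s = 2 * s + e by ring.
have -> : s + (s + e) = 2 * s + e by ring.
have -> : s + s = 2 * s + e - e by ring.
by field.
Qed.

Lemma increment_cov_offdiag (e s t : R) : 0 <= e -> e <= `|s - t| ->
  Q e s t = 2^-1 * D e `|s - t| \/
  Q e s t = 2^-1 * D e `|s - t| - 2^-1 * D e (s + t + e).
Proof.
move=> e0 est.
(* Since [e <= |s - t|], shifting one time by [e] does not change the sign of the difference, so the
   absolute values open the same way. *)
have fst : f `|s + e - t| + f `|s - (t + e)| = f (`|s - t| + e) + f (`|s - t| - e).
  have [st|ts] := leP t s.
    have u0 : 0 <= s - t by lra.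
    rewrite (ger0_norm u0) in est *.
    by rewrite !ger0_norm; [congr (f _ + f _); ring|lra|lra].
  have u0 : s - t <= 0 by lra.
  rewrite (ler0_norm u0) in est *.
  by rewrite !ler0_norm; [rewrite addrC; congr (f _ + f _); ring|lra|lra].
have E1 : s + e - (t + e) = s - t by ring.
rewrite /increment_cov; case: K_osc => ->; [left|right].
  rewrite !osc_fbm_covE E1 /D; lra.
rewrite !osc_subfbm_covE E1 /D.
have -> : s + e + (t + e) = s + t + e + e by ring.
have -> : s + (t + e) = s + t + e by ring.
have -> : s + e + t = s + t + e by ring.
have -> : s + t + e - e = s + t by ring.
lra.
Qed.

Lemma increment_cov_diag_le (e s : R) : 0 <= e -> 0 <= s -> Q e s s <= f e.
Proof.
move=> e0 s0; have h : e <= 2 * s + e by lra.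
have := variogram_diff2_ge0 e0 h.
by case: (increment_cov_diag e0 s0) => ->; lra.
Qed.

Lemma increment_cov_bias (e s : R) : 0 < e -> 2 * e <= s ->
  `|Q e s s / f e - 1| <= decay_cst * (e / s) `^ (2 - 2 * H).
Proof.
move=> e0 es; have s0 : 0 <= s by lra.
have fe := osc_variogram_gt0 a_gt0 a_lt1 b_gt0 H_gt H_lt1 e0.
have c0 : 0 <= decay_cst by rewrite mulr_ge0// powR_ge0.
case: (increment_cov_diag (ltW e0) s0) => ->.
  by rewrite divff ?gt_eqF// subrr normr0 mulr_ge0// powR_ge0.
have h1 : e <= 2 * s + e by lra.
have h2 : s <= 2 * s + e by lra.
have h3 := variogram_diff2_ge0 (ltW e0) h1.
have h4 := variogram_diff2_le e0 es h2.
rewrite mulrBl divff ?gt_eqF// addrAC subrr add0r normrN ger0_norm; last first.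
  by rewrite divr_ge0 ?(ltW fe)// mulr_ge0.
by rewrite ler_pdivrMr//; lra.
Qed.

(** Both second differences lie between 0 and the same bound, because [|s - t| <= s + t + e]; their
    difference therefore obeys it without a doubled constant. *)
Lemma increment_cov_decay (e s t : R) : 0 < e -> 0 <= s -> 0 <= t ->
  2 * e <= `|s - t| ->
  `|Q e s t / f e| <= decay_cst * (e / `|s - t|) `^ (2 - 2 * H).
Proof.
move=> e0 s0 t0 est.
have fe := osc_variogram_gt0 a_gt0 a_lt1 b_gt0 H_gt H_lt1 e0.
have est' : e <= `|s - t| by lra.
have stn : `|s - t| <= s + t by rewrite ler_norml; apply/andP; split; lra.
have h1 : `|s - t| <= s + t + e by lra.
have h2 : e <= s + t + e by lra.
have h3 := variogram_diff2_ge0 (ltW e0) est'.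
have h4 := variogram_diff2_ge0 (ltW e0) h2.
have h5 := variogram_diff2_le e0 est (lexx _).
have h6 := variogram_diff2_le e0 est h1.
rewrite normrM normfV (gtr0_norm fe) ler_pdivrMr// ler_norml.
by case: (increment_cov_offdiag (ltW e0) est') => ->; apply/andP; split; lra.
Qed.

(** For [2 * e <= u], squaring gives the exponent [4 - 4 * H], which may be lowered to [delta] as
    [e / u <= 1]. For smaller [u], [1 <= (2 * (e / u))^delta <= 2 * (e / u)^delta], which explains
    the added 2 and removes the restriction on [u]. *)
Lemma sqr_decay_le (delta e u x : R) : 0 < delta -> delta <= 4 - 4 * H -> delta <= 1 ->
  0 < e -> 0 < u -> `|x| <= 1 ->
  (2 * e <= u -> `|x| <= decay_cst * (e / u) `^ (2 - 2 * H)) ->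
  x ^+ 2 <= (decay_cst ^+ 2 + 2) * (e / u) `^ delta.
Proof.
move=> d0 dH d1 e0 u0 x1 hx.
have c0 : 0 <= decay_cst by rewrite mulr_ge0// powR_ge0.
have r0 : 0 < e / u by rewrite divr_gt0.
have p0 := powR_ge0 (e / u) delta.
rewrite -real_normK ?num_real//.
have [eu|ue] := leP (2 * e) u.
  apply: (@le_trans _ _ (decay_cst ^+ 2 * (e / u) `^ delta)); last first.
    by rewrite ler_wpM2r// lerDl.
  apply: (@le_trans _ _ ((decay_cst * (e / u) `^ (2 - 2 * H)) ^+ 2)).
    by rewrite ler_sqr ?nnegrE ?mulr_ge0 ?powR_ge0// hx.
  rewrite exprMn ler_wpM2l ?sqr_ge0// -powR_mulrn ?powR_ge0// -powRrM.
  rewrite ger_powR//; first by rewrite r0/= ler_pdivrMr// mul1r; lra.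
  by lra.
apply: (@le_trans _ _ 1); first by rewrite exprn_ile1.
apply: (@le_trans _ _ (2 * (e / u) `^ delta)); last first.
  by rewrite ler_wpM2r// lerDr sqr_ge0.
have h : 1 <= (2 * (e / u)) `^ delta.
  rewrite -[leLHS](powRr0 (2 * (e / u))) ler_powR ?(ltW d0)//.
  by rewrite mulrA ler_pdivlMr// mul1r ltW.
apply: le_trans h _; rewrite powRM ?(ltW r0)// ler_wpM2r//.
by apply: ler1_powR; lra.
Qed.

(** It bounds both the squared bias at time [k * eta] and the squared correlation at lag [k]. At
    [k = 0] the trivial bound 1 must be put in by hand, since division by 0 would make the power
    vanish. *)
Definition lag_bound (delta e eta : R) (k : nat) : R :=
  if k == 0%N then 1 else (decay_cst ^+ 2 + 2) * (e / (k%:R * eta)) `^ delta.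

Definition quadratic_cst (delta T : R) : R :=
  (decay_cst ^+ 2 + 2) * T `^ (1 - delta) / (1 - delta).

(** Lag 0 contributes [eta]; the rest is a Riemann sum of [(e / t)^delta] over [[0, T]], finite
    because [delta < 1]. Its bound is free of [eta], which allows the mesh to tend to 0 with [e]
    fixed. *)
Lemma sum_lag_bound_le (delta e eta T : R) (N : nat) : 0 < delta -> delta < 1 ->
  0 < e -> 0 < eta -> N%:R * eta <= T ->
  eta * \sum_(k < N) lag_bound delta e eta k <= eta + quadratic_cst delta T * e `^ delta.
Proof.
move=> d0 d1 e0 eta0 NT; have dd0 : 0 < 1 - delta by lra.
have M0 : 0 <= decay_cst ^+ 2 + 2 by rewrite addr_ge0// sqr_ge0.
have T0 : 0 <= T by apply: le_trans NT; rewrite mulr_ge0// ltW.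
have cst0 : 0 <= quadratic_cst delta T.
  by rewrite divr_ge0 ?(ltW dd0)// mulr_ge0// powR_ge0.
case: N NT => [_|N NT]; first by rewrite big_ord0 mulr0 addr_ge0 ?(ltW eta0)// mulr_ge0// powR_ge0.
rewrite big_ord_recl/= /lag_bound/= mulrDr mulr1 lerD2l.
have -> : \sum_(i < N) (decay_cst ^+ 2 + 2) * (e / ((bump 0 i)%:R * eta)) `^ delta =
    (decay_cst ^+ 2 + 2) * (e `^ delta * eta `^ (- delta)) * \sum_(i < N) i.+1%:R `^ (- delta).
  rewrite mulr_sumr; apply: eq_bigr => i _; rewrite /bump add1n -mulrA; congr (_ * _).
  have i0 : (0 : R) <= i.+1%:R by [].
  have ei : 0 <= i.+1%:R * eta by rewrite mulr_ge0// ltW.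
  rewrite powRM ?(ltW e0) ?invr_ge0// -powR_inv1// -powRrM mulN1r powRM ?(ltW eta0)//.
  by ring.
have h := sum_powRN_le N d0 d1.
have eta1 : eta * eta `^ (- delta) = eta `^ (1 - delta).
  by rewrite powRD ?powRr1 ?ltW//; apply/implyP => _; rewrite gt_eqF.
rewrite [leLHS](_ : _ = (decay_cst ^+ 2 + 2) * e `^ delta *
  (eta `^ (1 - delta) * \sum_(i < N) i.+1%:R `^ (- delta))); last first.
  by rewrite -eta1; ring.
have h3 : eta `^ (1 - delta) * \sum_(i < N) i.+1%:R `^ (- delta) <= T `^ (1 - delta) / (1 - delta).
  apply: (@le_trans _ _ (eta `^ (1 - delta) * (N%:R `^ (1 - delta) / (1 - delta)))).
    by rewrite ler_wpM2l// powR_ge0.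
  rewrite mulrA ler_wpM2r ?invr_ge0 ?(ltW dd0)// -powRM ?(ltW eta0)//.
  rewrite ge0_ler_powR ?nnegrE ?(ltW dd0) ?mulr_ge0 ?(ltW eta0)//.
  rewrite mulrC (le_trans _ NT)// ler_wpM2r ?(ltW eta0)// ler_nat.
  exact: leqnSn.
apply: le_trans (ler_wpM2l _ h3) _; first by rewrite mulr_ge0// powR_ge0.
by rewrite /quadratic_cst
  [leLHS](_ : _ = (decay_cst ^+ 2 + 2) * T `^ (1 - delta) / (1 - delta) * e `^ delta); [|ring].
Qed.

End covariance_bounds.

(** * Riemann sums of continuous functions converge to the Lebesgue integral *)

Section riemann_sums.
Context {R : realType}.
Notation mu := (@lebesgue_measure R).

(** Left endpoints and [n.+1] cells, so that it matches [quadratic_sum] with mesh [T / n.+1]. *)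
Definition riemann_sum (g : R -> R) (T : R) (n : nat) : R :=
  T / n.+1%:R * \sum_(i < n.+1) g (i%:R * (T / n.+1%:R)).

Let step (g : R -> R) (T : R) (n : nat) (t : R) : R :=
  \sum_(i < n.+1) g (i%:R * (T / n.+1%:R)) *
    \1_(`[i%:R * (T / n.+1%:R), i.+1%:R * (T / n.+1%:R)[%classic : set R) t.

Let integral_step (g : R -> R) (T : R) n : 0 < T ->
  (\int[mu]_t (step g T n t)%:E = (riemann_sum g T n)%:E)%E.
Proof.
move=> T0; pose h := T / n.+1%:R.
have h0 : 0 < h by rewrite divr_gt0.
pose I (i : nat) : set R := `[i%:R * h, i.+1%:R * h[%classic.
have ind i : (\int[mu]_t (\1_(I i) t)%:E)%E = h%:E.
  rewrite integral_indic//=; last exact: measurable_itv.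
  rewrite setIT /I lebesgue_measure_itv/= lte_fin ltr_pM2r// ltr_nat ltnSn.
  by rewrite -EFinB -mulrBl -natr1 addrAC subrr add0r mul1r.
have iind (i : nat) : mu.-integrable [set: R] (EFin \o (\1_(I i) : R -> R)).
  exact: integrable_indic_itv.
under eq_integral do rewrite -sumEFin.
rewrite integral_sum//; last first.
  move=> i; under eq_fun do rewrite EFinM.
  by apply: integrableZl => //; exact: iind.
rewrite /riemann_sum mulr_sumr -sumEFin; apply: eq_bigr => i _.
under eq_integral do rewrite EFinM.
by rewrite integralZl//; [rewrite ind -EFinM mulrC | exact: iind].
Qed.

Let step_in (g : R -> R) (T : R) n (t : R) : 0 < T -> 0 <= t -> t < T ->
  exists2 i : nat, step g T n t = g (i%:R * (T / n.+1%:R)) &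
    [/\ i%:R * (T / n.+1%:R) <= t, t - i%:R * (T / n.+1%:R) <= T / n.+1%:R &
      (i < n.+1)%N].
Proof.
move=> T0 t0 tT; pose h := T / n.+1%:R; rewrite /step -/h.
have h0 : 0 < h by rewrite divr_gt0.
have th0 : 0 <= t / h by rewrite divr_ge0// ltW.
pose i := Num.truncn (t / h).
have /andP[] := truncn_itv th0; rewrite -/i ler_pdivlMr// ltr_pdivrMr// => i1 i2.
have iN : (i < n.+1)%N.
  rewrite truncn_lt_nat// ltr_pdivrMr// /h mulrC divfK//.
exists i; last by split=> //; move: i2; rewrite -natr1 mulrDl mul1r; lra.
rewrite (bigD1 (Ordinal iN))//= big1 ?addr0; last first.
  move=> j ji; rewrite indicE memNset ?mulr0//= in_itv/= => /andP[j1 j2].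
  move/eqP: ji; apply; apply: val_inj => /=; apply/esym/truncn_def.
  by rewrite ler_pdivlMr// ltr_pdivrMr// j1.
by rewrite indicE mem_set ?mulr1//= in_itv/= i1.
Qed.

Let step_out (g : R -> R) (T : R) n (t : R) : 0 < T -> ~~ (0 <= t < T) -> step g T n t = 0.
Proof.
move=> T0 tT; apply: big1 => i _; rewrite indicE memNset ?mulr0//= in_itv/= => /andP[i1 i2].
have h0 : 0 < T / n.+1%:R by rewrite divr_gt0.
move/negP: tT; apply; apply/andP; split.
  by apply: le_trans i1; rewrite mulr_ge0// ltW.
apply: lt_le_trans i2 _; rewrite [leRHS](_ : _ = n.+1%:R * (T / n.+1%:R)).
  by rewrite ler_pM2r// ler_nat.
by rewrite mulrC divfK.
Qed.

(** Dominated convergence for the step functions: continuity at each point gives the pointwise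
    limit, and the extrema of [g] on [[0, T]] give a constant dominating function. *)
Lemma cvg_riemann_sum (g : R -> R) (T : R) : 0 < T ->
  {within `[0, T], continuous g} ->
  riemann_sum g T n @[n --> \oo] --> \int[mu]_(t in `[0, T]) g t.
Proof.
move=> T0 cg.
have [M Mg] : exists M : R, forall t : R, t \in `[0, T] -> `|g t| <= M.
  have [c1 _ h1] := EVT_max (ltW T0) cg.
  have [c2 _ h2] := EVT_min (ltW T0) cg.
  exists (`|g c1| + `|g c2|) => t tT; have := h1 _ tT; have := h2 _ tT.
  have := ler_norm (g c1); have := ler_norm (- g c2); rewrite normrN.
  have := normr_ge0 (g c1); have := normr_ge0 (g c2).
  by move=> ? ? ? ? ? ?; rewrite ler_norml; apply/andP; split; lra.
(* The step functions vanish at [T], so the limit is taken on the half-open interval; the endpoint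
   is restored as a null set at the end. *)
pose D : set R := `[0, T[%classic.
have mstep n : measurable_fun [set: R] (step g T n).
  apply: measurable_sum => i; apply: measurable_funM => //.
have hae : {ae mu, forall t, [set: R] t ->
    (step g T n t)%:E @[n --> \oo] --> (EFin \o (g \_ D)) t}.
  apply/aeW => t _.
  suff h : step g T n t @[n --> \oo] --> (g \_ D) t.
    by apply: cvg_EFin; [near=> n | exact: h].
  have [tT|tT] := boolP (0 <= t < T); last first.
    apply: cvg_near_cst; near=> n; rewrite step_out// patchE memNset//.
    by rewrite /D/= in_itv/=; exact/negP.
  rewrite patchE mem_set; last by rewrite /D/= in_itv.
  have /andP[t0 tT'] := tT.
  have tI : `[0, T]%classic t by rewrite /= in_itv/= t0 ltW.
  have := (subspace_continuousP _ _).1 cg t tI => /cvgrPdist_le cgt.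
  apply/cvgrPdist_le => e e0.
  have := cgt e e0; rewrite near_withinE => /nbhs_ballP[/= d d0 hd].
  near=> n.
  have [i -> [i1 i2 iN]] := step_in g n T0 t0 tT'.
  have nd : T / n.+1%:R < d.
    rewrite ltr_pdivrMr// mulrC -ltr_pdivrMr//.
    have : T / d <= n%:R by near: n; exact: nbhs_infty_ger.
    by rewrite -natr1; lra.
  have ih0 : 0 <= i%:R * (T / n.+1%:R) by rewrite mulr_ge0// divr_ge0// ltW.
  apply: hd; last by rewrite /= in_itv/= ih0 (le_trans i1)// ltW.
  by rewrite /ball/= ger0_norm ?subr_ge0//; exact: le_lt_trans i2 nd.
have intD (k : R -> R) : {within `[0, T], continuous k} ->
    mu.-integrable D (EFin \o k) /\ mu.-integrable [set: R] (EFin \o (k \_ D)).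
  move=> ck; have mD : measurable D by exact: measurable_itv.
  have iD : mu.-integrable D (EFin \o k).
    apply: (@integrableS _ _ _ mu `[0, T]%classic) => //.
      by apply: subset_itvl; rewrite bnd_simp.
    by apply: continuous_compact_integrable => //; exact: segment_compact.
  split=> //; rewrite -restrict_EFin; exact: (@integrable_mkcond _ _ _ mu D (EFin \o k) mD).1 iD.
have [igD igDT] := intD g cg.
have mgD := measurable_int _ igDT.
have cM : {within `[0, T], continuous (cst M : R -> R)}.
  by apply: continuous_subspaceT => x; exact: cvg_cst.
have [_ iM] := intD _ cM.
have hdom : {ae mu, forall t n, [set: R] t -> (`|(step g T n t)%:E| <= (EFin \o (cst M \_ D)) t)%E}.
  apply/aeW => t n _ /=; rewrite lee_fin; have [tT|tT] := boolP (0 <= t < T); last first.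
    by rewrite step_out// normr0 patchE memNset//= /D/= in_itv/=; exact/negP.
  have /andP[t0 tT'] := tT.
  have [i -> [i1 i2 iN]] := step_in g n T0 t0 tT'.
  rewrite patchE mem_set; last by rewrite /D/= in_itv.
  apply: Mg; rewrite in_itv/= (le_trans i1 (ltW tT')) andbT.
  by rewrite mulr_ge0// divr_ge0// ltW.
have mE n : measurable_fun [set: R] (EFin \o step g T n) by exact/measurable_EFinP.
have [_ _ h] := @dominated_convergence _ _ _ mu _ measurableT _ _ _ mE mgD hae iM hdom.
have {h} : (riemann_sum g T n)%:E @[n --> \oo] --> (\int[mu]_x (EFin \o (g \_ D)) x)%E.
  by apply: cvg_trans h; apply: near_eq_cvg; near=> n; rewrite -integral_step.
have -> : (\int[mu]_x (EFin \o (g \_ D)) x = (\int[mu]_(t in `[0, T]) g t)%:E)%E.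
  rewrite -(Rintegral_itv_bndo_bndc igD) /Rintegral fineK.
    by rewrite integral_mkcond restrict_EFin.
  by apply: (integrable_fin_num _ igD); exact: measurable_itv.
by move=> /fine_cvg.
Unshelve. all: by end_near. Qed.

End riemann_sums.

(** * From mean-square rates to convergence in L2 and almost surely *)

Section quadratic_variation.
Context {R : realType} d (Omega : measurableType d) (P : probability Omega R).
Notation mu := (@lebesgue_measure R).

Lemma Lnorm2E (g : Omega -> R) :
  ('N[P]_2%:E[EFin \o g] = (\int[P]_w (g w ^+ 2)%:E) `^ (2^-1))%E.
Proof.
rewrite unlock; congr (_ `^ _)%E; apply: eq_integral => w _ /=.
by rewrite (powR_mulrn 2)// real_normK// num_real.
Qed.

Lemma limn_einf_le_lim (u v : (\bar R)^nat) (l : \bar R) :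
  (forall n, u n <= v n)%E -> v n @[n --> \oo] --> l -> (limn_einf u <= l)%E.
Proof.
move=> uv vl; rewrite -(cvg_limn_einf_sup vl).1 !limn_einf_lim.
apply: lee_lim; [exact: is_cvg_einfs|exact: is_cvg_einfs|].
apply: nearW => n; apply: le_ereal_inf_tmp => _ [m /= nm <-].
by apply: le_trans (uv m); apply: ereal_inf_lbound; exists m.
Qed.

Lemma cvg_L2_power_rate (Y : R -> Omega -> R) (T C delta : R) : 0 < delta -> 0 <= C ->
  (forall e, 0 < e -> measurable_fun [set: Omega] (Y e)) ->
  (forall e, 0 < e -> (\int[P]_w ((Y e w - T) ^+ 2)%:E <= (C * e `^ delta)%:E)%E) ->
  cvg_L2 P (0 : R)^'+ Y (fun=> T).
Proof.
move=> d0 C0 mY YT; split; last first.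
- have Tc : (C * e `^ delta) `^ 2^-1 @[e --> (0 : R)^'+] --> (0 : R).
    have -> : (fun e : R => (C * e `^ delta) `^ 2^-1) =
       (fun e => C `^ 2^-1 * e `^ (delta / 2)).
      by apply/funext => e; rewrite powRM ?powR_ge0// -powRrM.
    rewrite -[X in _ --> X](mulr0 (C `^ 2^-1)); apply: cvgM; first exact: cvg_cst.
    by apply: powR_cvg0; lra.
  apply: (@squeeze_cvge _ _ _ _ (cst 0%E) _ (fun e => ((C * e `^ delta) `^ 2^-1)%:E)).
  + near=> e; rewrite Lnorm_ge0/= Lnorm2E.
    have e0 : 0 < e by near: e; exact: nbhs_right_gt.
    rewrite -poweR_EFin; apply: gt0_ler_poweR => //.
    * by rewrite in_itv/= leey integral_ge0// => w _; rewrite lee_fin sqr_ge0.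
    * by rewrite in_itv/= leey lee_fin mulr_ge0// powR_ge0.
    * exact: YT.
  + exact: cvg_cst.
  + by apply: cvg_EFin => //; near=> e.
- exact: Lfun_cst.
- near=> e.
  have e0 : 0 < e by near: e; exact: nbhs_right_gt.
  have mYT : measurable_fun [set: Omega] (fun w => Y e w - T).
    by apply: measurable_funB => //; exact: mY.
  rewrite inE; apply/andP; split; rewrite inE/=; first exact: mY.
  rewrite /finite_norm Lnorm2E poweR_lty//.
  (* The gap between this integrand and [Y e w ^+ 2] is [(Y e w - 2 * T) ^+ 2]. *)
  apply: (@le_lt_trans _ _ (\int[P]_w (2 * (Y e w - T) ^+ 2 + 2 * T ^+ 2)%:E)%E).
    apply: ge0_le_integral => //.
    - by move=> w _; rewrite lee_fin sqr_ge0.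
    - by apply/measurable_EFinP/measurable_funX; exact: mY.
    - apply/measurable_EFinP/measurable_funD => //.
      by apply: measurable_funM => //; exact: measurable_funX.
    - by move=> w _; rewrite lee_fin; have := sqr_ge0 (Y e w - 2 * T); nra.
  have iYT : P.-integrable [set: Omega] (EFin \o (fun w => (Y e w - T) ^+ 2)).
    apply/integrableP; split; first by apply/measurable_EFinP/measurable_funX.
    under eq_integral do rewrite /= ger0_norm ?sqr_ge0//.
    by apply: le_lt_trans (YT e e0) _; rewrite ltry.
  have := integrable_EFinD (integrable_EFinZ 2 iYT) (integrable_EFin_cst P (2 * T ^+ 2)).
  by move=> /(integrable_fin_num measurableT); rewrite ge0_fin_numE// integral_ge0// => w _;
    rewrite lee_fin addr_ge0// mulr_ge0// sqr_ge0.
Unshelve. all: by end_near. Qed.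

(** The series of squared errors has finite expectation, so it converges almost everywhere and its
    terms tend to 0; no Borel-Cantelli argument is involved. *)
Lemma cvg_as_power_rate (Y : R -> Omega -> R) (T C delta : R) (eps : nat -> R) : 0 <= C ->
  (forall e, 0 < e -> measurable_fun [set: Omega] (Y e)) ->
  (forall e, 0 < e -> (\int[P]_w ((Y e w - T) ^+ 2)%:E <= (C * e `^ delta)%:E)%E) ->
  (forall n, 0 < eps n) -> (\sum_(0 <= n <oo) (eps n `^ delta)%:E < +oo)%E ->
  cvg_as P (fun n => Y (eps n)) (fun=> T).
Proof.
move=> C0 mY YT eps0 sum_eps.
pose g n w := ((Y (eps n) w - T) ^+ 2)%:E.
have g0 n w : (0 <= g n w)%E by rewrite lee_fin sqr_ge0.
have mg n : measurable_fun [set: Omega] (g n).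
  by apply/measurable_EFinP/measurable_funX/measurable_funB => //; exact: mY.
have ig : P.-integrable [set: Omega] (fun w => \sum_(0 <= n <oo) g n w)%E.
  apply/integrableP; split; first exact: ge0_emeasurable_sum.
  under eq_integral do rewrite gee0_abs ?nneseries_ge0//.
  rewrite integral_nneseries//.
  apply: (@le_lt_trans _ _ (\sum_(0 <= n <oo) (C%:E * (eps n `^ delta)%:E))%E).
    apply: lee_nneseries => [n _ _|n _]; first by apply: integral_ge0 => w _; exact: g0.
    by rewrite -EFinM; exact: YT.
  rewrite nneseriesZl//; last by move=> n _; rewrite lee_fin powR_ge0.
  move: sum_eps; set S := (\sum_(_ <= _ <oo) _)%E => S1.
  have S0 : (0 <= S)%E by apply: nneseries_ge0 => n _ _; rewrite lee_fin powR_ge0.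
  by rewrite lte_mul_pinfty.
have := integrable_ae measurableT ig; apply: filterS => w /(_ I) gfin.
have gw n : (0%N <= n)%N -> xpredT n -> (0 <= g n w)%E by [].
have tail : (\sum_(n <= k <oo) g k w)%E @[n --> \oo] --> 0%E.
  apply: nneseries_tail_cvg => //.
  by rewrite -ge0_fin_numE// nneseries_ge0.
have g_cvg : g n w @[n --> \oo] --> 0%E.
  (* Each term is at most the tail that starts with it. *)
  apply: (@squeeze_cvge _ _ _ _ (cst 0%E) _ (fun n => \sum_(n <= k <oo) g k w)%E) => //.
    apply: nearW => n; rewrite g0/=.
    have := @nneseries_lim_ge R (fun k => g k w) xpredT n n.+1.
    rewrite big_nat1; apply; by move=> *; exact: g0.
  exact: cvg_cst.
have {g_cvg}h : (Y (eps n) w - T) ^+ 2 @[n --> \oo] --> (0 : R).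
  exact: fine_cvg g_cvg.
apply/cvgrPdist_lt => e e0.
have e20 : 0 < e ^+ 2 by rewrite exprn_gt0.
have /cvgr0Pnorm_lt/(_ _ e20) := h; apply: filterS => n.
rewrite ger0_norm ?sqr_ge0// -real_normK ?num_real// distrC.
by rewrite ltr_sqr ?nnegrE// ltW.
Qed.

(** * Mean-square rates for [V_var] and [U_var] *)

Context (a b H T : R).
Hypotheses (a_gt0 : 0 < a) (a_lt1 : a < 1) (b_gt0 : 0 < b) (T_gt0 : 0 < T).
Hypotheses (H_gt : 2^-1 < H) (H_lt1 : H < 1).
Local Notation f := (osc_variogram a b H).

Context (X : R -> Omega -> R) (K : R -> R -> R).
Hypothesis K_osc : K = osc_fbm_cov a b H \/ K = osc_subfbm_cov a b H.
Hypothesis Xgauss : centered_gaussian_process P X K.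
Hypothesis X_cont : continuous_paths X.

Context (delta : R).
Hypotheses (d0 : 0 < delta) (dH : delta <= 4 - 4 * H) (d1 : delta < 1).
Local Notation C0 := (quadratic_cst a H delta T).

Let fpos e : 0 < e -> 0 < f e.
Proof. exact: osc_variogram_gt0. Qed.

Lemma quadratic_sum_mean_square (e eta : R) (N : nat) :
  0 < e -> 0 < eta -> N%:R * eta <= T ->
  \int[P]_w ((quadratic_sum X (f e) e eta N w - eta * N%:R) ^+ 2) <=
  5 * T * (eta + C0 * e `^ delta).
Proof.
move=> e0 eta0 NT; have f0 := fpos e0.
rewrite (Rintegral_quadratic_sum Xgauss N f0 (ltW e0) (ltW eta0)).2.
pose k := lag_bound a H delta e eta.
have k0 n : 0 <= k n.
  by rewrite /k /lag_bound; case: ifP => // _; rewrite mulr_ge0 ?powR_ge0// addr_ge0// sqr_ge0.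
pose beta (i : nat) := increment_cov K e (i%:R * eta) (i%:R * eta) / f e - 1.
pose c (i j : nat) := increment_cov K e (i%:R * eta) (j%:R * eta) / f e.
have t0 (i : nat) : 0 <= i%:R * eta by rewrite mulr_ge0// ltW.
have cov0 (i : nat) := increment_cov_ge0 Xgauss (ltW e0) (t0 i).
have covf (i : nat) := increment_cov_diag_le a_gt0 a_lt1 b_gt0 H_gt H_lt1 K_osc (ltW e0) (t0 i).
have beta_le i : beta i ^+ 2 <= k i.
  have b1 : `|beta i| <= 1.
    have h1 : 0 <= increment_cov K e (i%:R * eta) (i%:R * eta) / f e.
      by rewrite divr_ge0// ltW.
    have h2 : increment_cov K e (i%:R * eta) (i%:R * eta) / f e <= 1.
      by rewrite ler_pdivrMr// mul1r.
    by rewrite ler_norml /beta; apply/andP; split; lra.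
  rewrite /k /lag_bound; case: eqP => [i0|/eqP i0].
    by rewrite -real_normK ?num_real// exprn_ile1.
  apply: (@sqr_decay_le _ a H) => //; first exact: ltW.
    by rewrite mulr_gt0// ltr0n lt0n.
  by move=> h; exact: (increment_cov_bias a_gt0 a_lt1 b_gt0 H_gt H_lt1 K_osc).
have c_le i j : c i j ^+ 2 <= k ((i - j) + (j - i))%N.
  have c1 : `|c i j| <= 1.
    rewrite /c normrM normfV (gtr0_norm f0) ler_pdivrMr// mul1r.
    apply: le_trans (increment_cov_le Xgauss (ltW e0) (t0 i) (t0 j)) _.
    by have := covf i; have := covf j; lra.
  rewrite /k /lag_bound; case: eqP => [i0|/eqP i0].
    by rewrite -real_normK ?num_real// exprn_ile1.
  have dist : `|i%:R * eta - j%:R * eta| = ((i - j) + (j - i))%N%:R * eta.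
    have [ij|ji] := leqP i j.
      have /eqP -> : (i - j == 0)%N by rewrite subn_eq0.
      rewrite add0n.
      rewrite distrC natrB// mulrBl ger0_norm// subr_ge0 ler_wpM2r ?(ltW eta0)// ler_nat//.
    have /eqP -> : (j - i == 0)%N by rewrite subn_eq0 ltnW.
    rewrite addn0.
    by rewrite natrB ?(ltnW ji)// mulrBl ger0_norm// subr_ge0 ler_wpM2r ?(ltW eta0)// ler_nat ltnW.
  apply: (@sqr_decay_le _ a H) => //; first exact: ltW.
    by rewrite mulr_gt0// ltr0n lt0n.
  rewrite -dist => h.
  exact: (increment_cov_decay a_gt0 a_lt1 b_gt0 H_gt H_lt1 K_osc).
pose S := \sum_(i < N) k i.
have hS : eta * S <= eta + C0 * e `^ delta.
  exact: sum_lag_bound_le.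
have S0 : 0 <= S by exact: sumr_ge0.
(* Young's inequality bounds [beta i * beta j] by [(k i + k j) / 2], which sums to [N * S]; twice
   the squared correlations sum to at most [4 * N * S]. Together they give the 5. *)
have sums : \sum_(i < N) \sum_(j < N) (beta i * beta j + 2 * c i j ^+ 2) <= 5 * N%:R * S.
  apply: (@le_trans _ _ (\sum_(i < N) \sum_(j < N)
      ((k i / 2 + k j / 2) + 2 * k ((i - j) + (j - i))%N))).
    apply: ler_sum => i _; apply: ler_sum => j _.
    have := beta_le i; have := beta_le j; have := c_le i j.
    have := sqr_ge0 (beta i - beta j); lra.
  have := sum_dist_le N k0; rewrite -/S => h.
  under eq_bigr do rewrite big_split/= big_split/= sumr_const card_ord -mulr_suml -mulr_sumr.
  rewrite big_split/= big_split/= sumr_const card_ord -mulr_sumr.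
  have -> : \sum_(i < N) k i / 2 *+ N = N%:R * S / 2.
    by rewrite /S mulr_sumr mulr_suml; apply: eq_bigr => i _; rewrite -mulr_natl mulrA.
  by rewrite -mulr_natl -/S; lra.
apply: (@le_trans _ _ (eta ^+ 2 * (5 * N%:R * S))).
  by rewrite ler_wpM2l ?sqr_ge0.
rewrite [leLHS](_ : _ = 5 * ((N%:R * eta) * (eta * S))); last by ring.
rewrite -[leRHS]mulrA ler_wpM2l//; apply: ler_pM => //; rewrite mulr_ge0// ltW//.
Qed.

Let C0_ge0 : 0 <= C0.
Proof.
rewrite /quadratic_cst divr_ge0// ?subr_ge0 ?(ltW d1)//.
by rewrite mulr_ge0 ?powR_ge0// addr_ge0// sqr_ge0.
Qed.

Lemma measurable_gaussian_process (t : R) : 0 <= t -> measurable_fun [set: Omega] (X t).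
Proof.
move=> t0; have [gX _ _] := Xgauss.
have [+ _] := gX 1%N (fun=> t) (fun=> 1) (fun=> t0).
rewrite (_ : (fun w => _) = X t)//; apply/funext => w.
by rewrite big_ord1 mul1r.
Qed.

Lemma measurable_quadratic_sum (F e eta : R) N : 0 <= e -> 0 <= eta ->
  measurable_fun [set: Omega] (quadratic_sum X F e eta N).
Proof.
move=> e0 eta0; apply: measurable_funM => //; apply: measurable_sum => i.
apply: measurable_funM => //; apply: measurable_funX.
have t0 : 0 <= i%:R * eta by rewrite mulr_ge0.
by apply: measurable_funB; apply: measurable_gaussian_process => //; rewrite addr_ge0.
Qed.

Lemma within_continuous_increment (F e : R) (w : Omega) : 0 <= e ->
  {within `[0, T], continuous (fun t => increment X e t w ^+ 2 / F)}.
Proof.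
move=> e0; apply/subspace_continuousP => t /= tT.
have cX := (subspace_continuousP _ _).1 (@X_cont w).
have t0 : 0 <= t by move: tT; rewrite in_itv/= => /andP[].
have te0 : `[0, +oo[%classic (t + e) by rewrite /= in_itv/= andbT addr_ge0.
have tt0 : `[0, +oo[%classic t by rewrite /= in_itv/= andbT.
apply: cvgM; last exact: cvg_cst.
apply: (cvg_comp _ (fun x => x ^+ 2)); last exact: exprn_continuous.
apply: cvgB.
- move=> U HU.
  have hU : \forall y \near (t + e), `[0, +oo[%classic y -> U (X y w) := cX _ te0 U HU.
  change (\forall s \near t, `[0, T]%classic s -> U (X (s + e) w)).
  have shift : (s + e) @[s --> t] --> t + e.
    by apply: cvgD; [exact: cvg_id | exact: cvg_cst].
  have hs : \forall s \near t, `[0, +oo[%classic (s + e) -> U (X (s + e) w) := shift _ hU.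
  apply: filterS hs => s /= h; rewrite in_itv/= => /andP[s0 _].
  by apply: h; rewrite in_itv/= andbT addr_ge0.
- move=> U HU.
  have hU : \forall y \near t, `[0, +oo[%classic y -> U (X y w) := cX _ tt0 U HU.
  change (\forall s \near t, `[0, T]%classic s -> U (X s w)).
  apply: filterS hU => s /= h; rewrite in_itv/= => /andP[s0 _].
  by apply: h; rewrite in_itv/= andbT.
Qed.

Let Vn (e : R) (w : Omega) := \int[mu]_(t in `[0, T]) (increment X e t w ^+ 2 / f e).

Lemma V_varE (e : R) (w : Omega) : 0 < e ->
  (osc_h a b H e)^-1 * V_var H T X e w = Vn e w.
Proof.
move=> e0; rewrite /Vn RintegralZr//.
  rewrite /osc_variogram invfM -powRN /V_var mulrA mulrC; congr (_ * _); exact: mulrC.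
have := @within_continuous_increment 1 e w (ltW e0).
rewrite (_ : (fun t => _ / 1) = (fun t => increment X e t w ^+ 2)); last first.
  by apply/funext => t; rewrite divr1.
by move=> c; apply: continuous_compact_integrable => //; exact: segment_compact.
Qed.

Let Rn (e : R) (n : nat) (w : Omega) :=
  quadratic_sum X (f e) e (T / n.+1%:R) n.+1 w.

Let Rn_cvg (e : R) (w : Omega) : 0 < e -> Rn e n w @[n --> \oo] --> Vn e w.
Proof.
move=> e0; apply: (@cvg_riemann_sum _ (fun t => increment X e t w ^+ 2 / f e) T T_gt0).
exact/within_continuous_increment/ltW.
Qed.

Let Tn_ge0 (n : nat) : 0 <= T / n.+1%:R.
Proof. by rewrite divr_ge0// ltW. Qed.

(** Continuity of the paths makes the variable a pointwise limit of finite quadratic sums, so joint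
    measurability of the process is not called upon. *)
Lemma measurable_V_var (e : R) : 0 < e ->
  measurable_fun [set: Omega] (fun w => (osc_h a b H e)^-1 * V_var H T X e w).
Proof.
move=> e0; apply: (@measurable_fun_cvg _ _ _ _ (Rn e)).
  by move=> n; apply: measurable_quadratic_sum => //; exact: ltW.
by move=> w _; rewrite V_varE//; exact: Rn_cvg.
Qed.

Lemma EFin_quadratic_sum_mean_square (e eta : R) (N : nat) :
  0 < e -> 0 < eta -> N%:R * eta <= T ->
  (\int[P]_w ((quadratic_sum X (f e) e eta N w - eta * N%:R) ^+ 2)%:E <=
  (5 * T * (eta + C0 * e `^ delta))%:E)%E.
Proof.
move=> e0 eta0 NT.
have [iQ _] := Rintegral_quadratic_sum Xgauss N (fpos e0) (ltW e0) (ltW eta0).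
rewrite -[leLHS]fineK; last exact: integrable_fin_num iQ.
by rewrite lee_fin; exact: quadratic_sum_mean_square.
Qed.

Lemma V_var_mean_square (e : R) : 0 < e ->
  (\int[P]_w (((osc_h a b H e)^-1 * V_var H T X e w - T) ^+ 2)%:E <=
   (5 * T * C0 * e `^ delta)%:E)%E.
Proof.
move=> e0.
pose u n w := ((Rn e n w - T) ^+ 2)%:E.
have uV w : (((osc_h a b H e)^-1 * V_var H T X e w - T) ^+ 2)%:E = limn_einf (u ^~ w).
  rewrite V_varE//; apply/esym/(cvg_limn_einf_sup _).1.
  apply: cvg_EFin; first by near=> n.
  apply: (cvg_comp (fun n => Rn e n w - T) (fun x => x ^+ 2)); last exact: exprn_continuous.
  by apply: cvgB; [exact: Rn_cvg | exact: cvg_cst].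
under eq_integral do rewrite uV.
apply: le_trans (fatou P measurableT _ _) _.
- move=> n; apply/measurable_EFinP/measurable_funX/measurable_funB => //.
  by apply: measurable_quadratic_sum => //; exact: ltW.
- by move=> n w _; rewrite lee_fin sqr_ge0.
apply: (@limn_einf_le_lim _ (fun n => (5 * T * (T / n.+1%:R + C0 * e `^ delta))%:E)).
  move=> n; have n0 : (0 : R) < n.+1%:R by rewrite ltr0n.
  (* This mesh fills [[0, T]] exactly, so the centring is [T] itself and no boundary error
     arises. *)
  have Tn : T / n.+1%:R * n.+1%:R = T by rewrite divfK// gt_eqF.
  have := @EFin_quadratic_sum_mean_square e (T / n.+1%:R) n.+1 e0 (divr_gt0 T_gt0 n0).
  by rewrite Tn mulrC Tn lexx => /(_ isT).
apply: cvg_EFin; first by near=> n.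
rewrite -mulrA; apply: cvgM; first exact: cvg_cst.
rewrite -[X in _ --> X]add0r; apply: cvgD; last exact: cvg_cst.
rewrite -[X in _ --> X](mulr0 T); apply: cvgM; first exact: cvg_cst.
exact: cvg_harmonic.
Unshelve. all: by end_near. Qed.

Lemma U_varE (e : R) (w : Omega) : 0 < e ->
  (osc_h a b H e)^-1 * U_var H T X e w =
  quadratic_sum X (f e) e e (Num.truncn (T / e)) w.
Proof.
move=> e0; rewrite /U_var /quadratic_sum big_add1/= big_mkord -mulr_suml.
rewrite powRD; last by apply/implyP => _; rewrite gt_eqF.
rewrite powRr1 ?ltW// /osc_variogram invfM -powRN.
rewrite [X in _ = _ * (X * _)](_ : _ = \sum_(i < Num.truncn (T / e))
    (X (i.+1%:R * e) w - X (i%:R * e) w) ^+ 2); first by ring.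
by apply: eq_bigr => i _; rewrite /increment -natr1 mulrDl mul1r.
Qed.

Lemma measurable_U_var (e : R) : 0 < e ->
  measurable_fun [set: Omega] (fun w => (osc_h a b H e)^-1 * U_var H T X e w).
Proof.
move=> e0; under eq_fun do rewrite U_varE//.
by apply: measurable_quadratic_sum; exact: ltW.
Qed.

(** The first summand is twice the bound for the centred sum, with [e] replaced by
    [T^(1 - delta) * e^delta]; the second is twice the boundary error [T * e], treated likewise. *)
Definition U_var_cst : R := 10 * T * (T `^ (1 - delta) + C0) + 2 * T * T `^ (1 - delta).

(** Besides the fluctuation around [e * N] there is the uncovered piece [T - e * N]; the square of
    the sum is split by [(x + y)^2 <= 2 x^2 + 2 y^2]. *)
Lemma U_var_mean_square (e : R) : 0 < e ->
  (\int[P]_w (((osc_h a b H e)^-1 * U_var H T X e w - T) ^+ 2)%:E <=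
   (U_var_cst * e `^ delta)%:E)%E.
Proof.
move=> e0; under eq_integral do rewrite U_varE//.
have T0 := ltW T_gt0; have dd0 : 0 <= 1 - delta by rewrite subr_ge0 ltW.
have Td0 := powR_ge0 T (1 - delta); have ed0 := powR_ge0 e delta.
have powD (x : R) : 0 < x -> x `^ (1 - delta) * x `^ delta = x.
  move=> x0; rewrite -powRD; last by apply/implyP => _; rewrite gt_eqF.
  by rewrite subrK powRr1// ltW.
have Te0 : 0 <= T / e by rewrite divr_ge0// ltW.
set N := Num.truncn (T / e).
have /andP[] := truncn_itv Te0; rewrite -/N ler_pdivlMr// ltr_pdivrMr// => NT TN.
(* For [e > T] the sum is empty and the error is [T ^+ 2], which is at most
   [T * T^(1 - delta) * e^delta]. *)
have [eT|Te] := leP e T; last first.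
  have N0 : N = 0%N.
    apply/eqP; rewrite -leqn0 leqNgt; apply/negP => N0.
    have : (1 : R) <= N%:R by rewrite ler1n.
    by move: NT Te e0; nra.
  under eq_integral do rewrite N0 /quadratic_sum big_ord0 mulr0 sub0r sqrrN.
  have := expectation_cst P (T ^+ 2); rewrite unlock => ->; rewrite lee_fin.
  have h : T `^ delta <= e `^ delta by rewrite ge0_ler_powR ?nnegrE ?(ltW d0) ?(ltW e0) ?(ltW Te).
  have := powD T T_gt0 => hT.
  have : T * T `^ (1 - delta) * T `^ delta <= T * T `^ (1 - delta) * e `^ delta.
    by rewrite ler_wpM2l// mulr_ge0.
  rewrite -mulrA hT /U_var_cst => h2.
  have : 0 <= (10 * T * (T `^ (1 - delta) + C0) + T * T `^ (1 - delta)) * e `^ delta.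
    by rewrite mulr_ge0// addr_ge0 ?mulr_ge0 ?addr_ge0.
  by rewrite expr2; lra.
have eTd : e <= T `^ (1 - delta) * e `^ delta.
  rewrite -{1}(powD e e0) ler_wpM2r//.
  by rewrite ge0_ler_powR ?nnegrE ?(ltW e0).
have [iQ _] := Rintegral_quadratic_sum Xgauss N (fpos e0) (ltW e0) (ltW e0).
have hQ := quadratic_sum_mean_square e0 e0 NT.
set Q := quadratic_sum X (f e) e e N in iQ hQ *.
have mQ : measurable_fun [set: Omega] Q by apply: measurable_quadratic_sum; exact: ltW.
(* The uncovered length is at most [e] and at most [T]. *)
have bias : (T - e * N%:R) ^+ 2 <= T * e.
  by rewrite -natr1 in TN; have N0 : (0 : R) <= N%:R by []; move: NT TN eT e0 N0 T0; nra.
have i2 := integrable_EFinD (integrable_EFinZ 2 iQ) (integrable_EFin_cst P (2 * (T * e))).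
apply: (@le_trans _ _ (\int[P]_w (2 * (Q w - e * N%:R) ^+ 2 + 2 * (T * e))%:E)%E).
  apply: ge0_le_integral => //.
  - by move=> w _; rewrite lee_fin sqr_ge0.
  - by apply/measurable_EFinP/measurable_funX/measurable_funB.
  - exact: measurable_int i2.
  - move=> w _; rewrite lee_fin; have := sqr_ge0 (Q w - e * N%:R + (T - e * N%:R)).
    by move: bias; nra.
rewrite -[leLHS]fineK; last exact: integrable_fin_num i2.
rewrite lee_fin -/(Rintegral _ _ _) RintegralD//; last 2 first.
- exact: integrable_EFinZ.
- exact: integrable_EFin_cst.
rewrite RintegralZl// Rintegral_prob_cst.
have : 5 * T * (e + C0 * e `^ delta) <= 5 * T * (T `^ (1 - delta) * e `^ delta + C0 * e `^ delta).
  by rewrite ler_wpM2l ?mulr_ge0// lerD2r.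
have : T * e <= T * (T `^ (1 - delta) * e `^ delta) by rewrite ler_wpM2l.
by rewrite /U_var_cst; lra.
Qed.

End quadratic_variation.

Theorem proposition2p18 (d : measure_display) (Omega : measurableType d)
    (R : realType) (P : probability Omega R) (a b T H : R)
    (X : R -> Omega -> R)
    (a_gt0 : 0 < a) (a_lt1 : a < 1) (b_gt0 : 0 < b) (T_gt0 : 0 < T)
    (H_gt : 2^-1 < H) (H_lt1 : H < 1)
    (X_osc : osc_fbm P a b H X \/ osc_subfbm P a b H X)
    (X_cont : continuous_paths X) :
  (cvg_L2 P (0 : R)^'+
     (fun eps w => (osc_h a b H eps)^-1 * V_var H T X eps w) (fun _ => T) /\
   forall eps : nat -> R, (forall n, 0 < eps n) ->
     (exists delta : R, [/\ 0 < delta, delta < Num.min (4 - 4 * H) 1 &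
       (\sum_(0 <= n <oo) (eps n `^ delta)%:E < +oo)%E]) ->
     cvg_as P (fun n w => (osc_h a b H (eps n))^-1 * V_var H T X (eps n) w)
       (fun _ => T))
  /\
  (cvg_L2 P (0 : R)^'+
     (fun eps w => (osc_h a b H eps)^-1 * U_var H T X eps w) (fun _ => T) /\
   forall eps : nat -> R, (forall n, 0 < eps n) ->
     (exists delta : R, [/\ 0 < delta, delta < Num.min (4 - 4 * H) 1 &
       (\sum_(0 <= n <oo) (eps n `^ delta)%:E < +oo)%E]) ->
     cvg_as P (fun n w => (osc_h a b H (eps n))^-1 * U_var H T X (eps n) w)
       (fun _ => T)).
Proof.
have [K [K_osc Xgauss]] : exists K,
    (K = osc_fbm_cov a b H \/ K = osc_subfbm_cov a b H) /\
    centered_gaussian_process P X K.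
  by case: X_osc => h; [exists (osc_fbm_cov a b H) | exists (osc_subfbm_cov a b H)];
    split=> //; [left | right].
have d0_gt0 : 0 < Num.min (4 - 4 * H) 1 by rewrite lt_min ltr01 andbT; lra.
(* L2 convergence only needs one admissible exponent, and half of the upper limit will do; the
   almost sure statements use the exponent supplied with the sequence. *)
have d0_rate : 0 < Num.min (4 - 4 * H) 1 / 2 < Num.min (4 - 4 * H) 1.
  by apply/andP; split; lra.
have rates delta : 0 < delta < Num.min (4 - 4 * H) 1 -> delta <= 4 - 4 * H /\ delta < 1.
  by case/andP => _; rewrite lt_min => /andP[/ltW].
pose C delta := quadratic_cst a H delta T.
have C_ge0 delta : delta < 1 -> 0 <= C delta.
  move=> d1; rewrite /C /quadratic_cst divr_ge0 ?subr_ge0 ?(ltW d1)//.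
  by rewrite mulr_ge0 ?powR_ge0// addr_ge0// sqr_ge0.
have T_ge0 := ltW T_gt0.
have CV_ge0 delta : delta < 1 -> 0 <= 5 * T * C delta.
  by move=> d1; apply: mulr_ge0 (C_ge0 _ d1); rewrite mulr_ge0.
have CU_ge0 delta : delta < 1 -> 0 <= U_var_cst a H T delta.
  move=> d1; apply: addr_ge0; last by rewrite !mulr_ge0// powR_ge0.
  by apply: mulr_ge0; [rewrite mulr_ge0 | exact: addr_ge0 (powR_ge0 _ _) (C_ge0 _ d1)].
have mV e : 0 < e -> measurable_fun [set: Omega] (fun w => (osc_h a b H e)^-1 * V_var H T X e w).
  exact: (measurable_V_var a b H T_gt0 Xgauss X_cont).
have mU e : 0 < e -> measurable_fun [set: Omega] (fun w => (osc_h a b H e)^-1 * U_var H T X e w).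
  exact: (measurable_U_var a b H T Xgauss).
have V2 delta : 0 < delta < Num.min (4 - 4 * H) 1 -> forall e, 0 < e ->
    (\int[P]_w (((osc_h a b H e)^-1 * V_var H T X e w - T) ^+ 2)%:E <=
     (5 * T * C delta * e `^ delta)%:E)%E.
  move=> dd; have [dH d1] := rates _ dd; have /andP[d0 _] := dd => e e0.
  exact: (V_var_mean_square a_gt0 a_lt1 b_gt0 T_gt0 H_gt H_lt1 K_osc Xgauss X_cont d0 dH d1).
have U2 delta : 0 < delta < Num.min (4 - 4 * H) 1 -> forall e, 0 < e ->
    (\int[P]_w (((osc_h a b H e)^-1 * U_var H T X e w - T) ^+ 2)%:E <=
     (U_var_cst a H T delta * e `^ delta)%:E)%E.
  move=> dd; have [dH d1] := rates _ dd; have /andP[d0 _] := dd => e e0.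
  exact: (U_var_mean_square a_gt0 a_lt1 b_gt0 T_gt0 H_gt H_lt1 K_osc Xgauss d0 dH d1).
have [_ d1] := rates _ d0_rate; have /andP[d0 _] := d0_rate.
split; split.
- exact: (cvg_L2_power_rate d0 (CV_ge0 _ d1) mV (V2 _ d0_rate)).
- move=> eps eps0 [delta [del0 delm sum_eps]].
  have dd : 0 < delta < Num.min (4 - 4 * H) 1 by rewrite del0.
  have [_ del1] := rates _ dd.
  exact: (cvg_as_power_rate (CV_ge0 _ del1) mV (V2 _ dd) eps0 sum_eps).
- exact: (cvg_L2_power_rate d0 (CU_ge0 _ d1) mU (U2 _ d0_rate)).
- move=> eps eps0 [delta [del0 delm sum_eps]].
  have dd : 0 < delta < Num.min (4 - 4 * H) 1 by rewrite del0.
  have [_ del1] := rates _ dd.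
  exact: (cvg_as_power_rate (CU_ge0 _ del1) mU (U2 _ dd) eps0 sum_eps).
Qed.
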